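(* Let $p$ be a prime, let $n\in\mathbb{N}$, $n\ge1$, let $T\in GL(n,\mathbb{Q}_p)$, and let $\overline{T}:\mathcal{S}_n\to\mathcal{S}_n$ be the homeomorphism $\overline{T}(x)=\|T(x)\|_p\,T(x)$. (a) If $bT$ is distal (on $\mathbb{Q}_p^n$) for some $b\in\mathbb{Q}_p\setminus\{0\}$, then $\overline{T}$ is distal (on $\mathcal{S}_n$). (b) Conversely, if $\overline{T}$ is distal, then for some $m\in\mathbb{N}$ (with $m\ge1$) and some $l\in\mathbb{Z}$, $p^lT^m$ is distal (on $\mathbb{Q}_p^n$). (c) If $|\det T|_p=1$ and $\overline{T}$ is distal, then $T$ is distal (on $\mathbb{Q}_p^n$).
   Context: Here $|\cdot|_p$ is the $p$-adic absolute value on $\mathbb{Q}_p$, and for $x=(x_1,\dots,x_n)\in\mathbb{Q}_p^n$, $\|x\|_p=\max_{1\le i\le n}|x_i|_p$. The $p$-adic unit sphere is $\mathcal{S}_n=\{x\in\mathbb{Q}_p^n\mid\|x\|_p=1\}$. For nonzero $v\in\mathbb{Q}_p^n$, $\|v\|_p$ is an integer power $p^m$ of $p$, and in the expression $\|v\|_p\,v$ this power is regarded as the scalar $p^m\in\mathbb{Q}_p$; thus $\|v\|_p\,v$ has norm $1$. A homeomorphism $\phi$ of a Hausdorff topological space $X$ is distal if for every pair of distinct $x,y\in X$, the closure of $\{(\phi^k(x),\phi^k(y))\mid k\in\mathbb{Z}\}$ in $X\times X$ does not intersect the diagonal $\{(d,d)\mid d\in X\}$. An element of $GL(n,\mathbb{Q}_p)$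 is called distal if it is distal as a homeomorphism of $\mathbb{Q}_p^n$. *)

(* Defs.v *)
From HB Require Import structures.
From mathcomp Require Import all_boot all_order all_algebra.
From mathcomp Require Import generic_quotient ring_quotient.
From mathcomp Require Import all_classical reals topology normedtype sequences.
From mathcomp Require Import zify ring lra.

Set Implicit Arguments.
Unset Strict Implicit.
Unset Printing Implicit Defensive.

Import Order.TTheory GRing.Theory Num.Theory numFieldNormedType.Exports.

Local Open Scope classical_set_scope.
Local Open Scope quotient_scope.
Local Open Scope ring_scope.

(* The p-adic absolute value on the rationals; powers of [p] are rational, so
   no real numbers are needed for its values. *)
Definition ratpabs (p : nat) (x : rat) : rat :=
  if x == 0 then 0
  else p%:R ^ ((logn p `|denq x|)%:Z - (logn p `|numq x|)%:Z).

Section RationalAbs.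
Variables (p : nat) (p_pr : prime p).
Local Notation "`[ x ]" := (ratpabs p x).

Let p_gt0 : 0 < p%:R :> rat.
Proof. by rewrite ltr0n prime_gt0. Qed.

Let p_ge1 : 1 <= p%:R :> rat.
Proof. by rewrite ler1n prime_gt0. Qed.

Let pexp_gt0 (k : int) : 0 < p%:R ^ k :> rat.
Proof. by rewrite exprz_gt0. Qed.

Lemma ratpabs0 : `[0] = 0. Proof. by rewrite /ratpabs eqxx. Qed.

Lemma ratpabs_ge0 x : 0 <= `[x].
Proof. by rewrite /ratpabs; case: eqP => // _; apply/ltW/pexp_gt0. Qed.

Lemma ratpabs_eq0 x : (`[x] == 0) = (x == 0).
Proof.
by rewrite /ratpabs; have [//|_] := eqVneq x 0; apply/negbTE/lt0r_neq0/pexp_gt0.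
Qed.

Lemma ratpabs_frac (a b : int) : a != 0 -> b != 0 ->
  `[a%:~R / b%:~R] = p%:R ^ ((logn p `|b|)%:Z - (logn p `|a|)%:Z).
Proof.
move=> a0 b0; have q0 : a%:~R / b%:~R != 0 :> rat.
  by rewrite mulf_neq0 ?invr_eq0 ?intr_eq0.
rewrite /ratpabs (negbTE q0); congr (_ ^ _).
set q := _ / _ in q0 *.
have e : (numq q * b = a * denq q)%R.
  apply/eqP; rewrite -(@eqr_int rat) !rmorphM /= numqE /q.
  have b0' : b%:~R != 0 :> rat by rewrite intr_eq0.
  by apply/eqP; field.
have := congr1 (fun z : int => logn p `|z|%N) e.
have nq0 : numq q != 0 by rewrite numq_eq0.
by rewrite !abszM !lognM ?absz_gt0 ?denq_neq0 //; lia.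
Qed.

Lemma ratpabs1 : `[1] = 1.
Proof. by rewrite /ratpabs oner_eq0 /= logn1 subrr expr0z. Qed.

Lemma ratpabsM x y : `[x * y] = `[x] * `[y].
Proof.
have [->|x0] := eqVneq x 0; first by rewrite mul0r ratpabs0 mul0r.
have [->|y0] := eqVneq y 0; first by rewrite mulr0 ratpabs0 mulr0.
rewrite -[x]divq_num_den -[y]divq_num_den mulf_div -!intrM.
rewrite !ratpabs_frac ?mulf_neq0 ?denq_neq0 ?numq_eq0 //.
rewrite -expfzDr ?lt0r_neq0 //; congr (_ ^ _).
rewrite !abszM !lognM ?absz_gt0 ?denq_neq0 ?numq_eq0 //.
by rewrite !PoszD; lia.
Qed.

Lemma ratpabsN x : `[- x] = `[x].
Proof.
by rewrite /ratpabs oppr_eq0 numqN denqN abszN.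
Qed.

Lemma ratpabs_addint (a b : int) : `[(a + b)%:~R] <= Num.max `[a%:~R] `[b%:~R].
Proof.
have absE (z : int) : z != 0 -> `[z%:~R] = p%:R ^ (- (logn p `|z|)%:Z).
  move=> z0; rewrite -[z%:~R]divr1 (_ : 1 = 1%:~R) // ratpabs_frac //.
  by rewrite logn1 sub0r.
have [->|a0] := eqVneq a 0; first by rewrite add0r le_max lexx orbT.
have [->|b0] := eqVneq b 0; first by rewrite addr0 le_max lexx.
have [->|ab0] := eqVneq (a + b) 0.
  by rewrite ratpabs0 le_max ratpabs_ge0.
rewrite !absE // le_max; apply/orP.
have dvdE (z : int) k : z != 0 -> (k <= logn p `|z|)%N = (((p ^ k)%N : int) %| z)%Z.
  by move=> z0; rewrite -pfactor_dvdn ?absz_gt0 // dvdzE absz_nat.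
have [le|/ltnW le] := leqP (logn p `|a|) (logn p `|b|); [left|right].
all: apply: ler_weXz2l => //; rewrite lerN2 lez_nat dvdE //.
all: by apply: rpredD; rewrite -dvdE.
Qed.

Lemma ratpabsD x y : `[x + y] <= Num.max `[x] `[y].
Proof.
pose d := denq x * denq y.
have d0 : d%:~R != 0 :> rat by rewrite intr_eq0 mulf_neq0 ?denq_neq0.
have dx0 : (denq x)%:~R != 0 :> rat by rewrite intr_eq0 denq_neq0.
have dy0 : (denq y)%:~R != 0 :> rat by rewrite intr_eq0 denq_neq0.
have ex : x = (numq x * denq y)%:~R / d%:~R.
  by rewrite -{1}[x]divq_num_den /d !rmorphM /=; field; rewrite dx0 dy0.
have ey : y = (numq y * denq x)%:~R / d%:~R.
  by rewrite -{1}[y]divq_num_den /d !rmorphM /=; field; rewrite dx0 dy0.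
rewrite ex ey -mulrDl !ratpabsM -maxr_pMl ?ratpabs_ge0 //.
by rewrite ler_wpM2r ?ratpabs_ge0 // -rmorphD ratpabs_addint.
Qed.

Lemma ratpabsB x y : `[x - y] = `[y - x].
Proof. by rewrite -opprB ratpabsN. Qed.

Lemma ratpabsV x : `[x^-1] = `[x]^-1.
Proof.
have [->|x0] := eqVneq x 0; first by rewrite !(invr0, ratpabs0).
apply: (@mulIf _ `[x]); first by rewrite ratpabs_eq0.
by rewrite -ratpabsM !mulVf ?ratpabs_eq0 // ratpabs1.
Qed.

Lemma ratpabs_p (k : int) : `[p%:R ^ k] = p%:R ^ (- k).
Proof.
have e : `[p%:R] = p%:R^-1.
  have := @ratpabs_frac p%:Z 1; rewrite divr1 => ->//.
    by rewrite absz_nat logn1 logn_prime // eqxx sub0r.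
  by have := prime_gt0 p_pr; lia.
have en (n : nat) : `[p%:R ^+ n] = p%:R ^- n.
  elim: n => [|n IH]; first by rewrite !expr0 ratpabs1 invr1.
  by rewrite !exprS ratpabsM IH e invfM.
case: k => n; first by rewrite /= en -exprnN.
by rewrite NegzE opprK -exprnN ratpabsV -exprnP en invrK.
Qed.

Lemma ratpabs_dist x y : `| `[x] - `[y] | <= `[x - y].
Proof.
have H a b : `[a] <= `[b] + `[a - b].
  rewrite -{1}[a](subrK b) (le_trans (ratpabsD _ _)) // ge_max.
  by rewrite lerDr ratpabs_ge0 lerDl ratpabs_ge0.
rewrite ler_norml; apply/andP; split; last by rewrite lerBlDl H.
by rewrite lerNl opprB lerBlDl ratpabsB H.
Qed.

Lemma ratpabs_eq x y : `[x - y] < `[y] -> `[x] = `[y].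
Proof.
move=> h; apply/eqP; rewrite eq_le; apply/andP; split.
  by rewrite -[x](subrK y) (le_trans (ratpabsD _ _)) // ge_max (ltW h) lexx.
have : `[y] <= Num.max `[y - x] `[x] by rewrite -{1}[y](subrK x) ratpabsD.
by rewrite ratpabsB le_max leNgt h.
Qed.

End RationalAbs.

(* The field of p-adic numbers is the completion of the rationals for
   [ratpabs p]: Cauchy sequences modulo null sequences. The proof of primality
   is a parameter of the types because the quotient is a field only when [p]
   is prime, and canonical instances must be able to find it. *)
Section CauchySequences.
Variables (p : nat) (p_pr : prime p).
Local Notation "`[ x ]" := (ratpabs p x).

Definition padic_cauchy of prime p : {pred nat -> rat} := fun u =>
  `[< forall e : rat, 0 < e ->
      exists N, forall m n, (N <= m)%N -> (N <= n)%N -> `[u m - u n] < e >].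

Local Notation cauchy := (padic_cauchy p_pr).

Lemma padic_cauchyP u : reflect (forall e : rat, 0 < e ->
  exists N, forall m n, (N <= m)%N -> (N <= n)%N -> `[u m - u n] < e)
  (u \in cauchy).
Proof. exact: asboolP. Qed.

Lemma cauchy_bounded u : u \in cauchy -> exists2 M, 0 < M & forall n, `[u n] <= M.
Proof.
move=> /padic_cauchyP/(_ 1 ltr01)[N uN].
pose M := \sum_(i < N.+1) `[u i] + 1.
have s0 : 0 <= \sum_(i < N.+1) `[u i] by rewrite sumr_ge0 // => i _; exact: ratpabs_ge0.
have small i : (i <= N)%N -> `[u i] <= M.
  move=> iN; rewrite /M (bigD1 (inord i)) //= inordK ?ltnS // -addrA lerDl.
  by rewrite addr_ge0 // sumr_ge0 // => j _; exact: ratpabs_ge0.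
exists M; first by rewrite /M; lra.
move=> n; have [/small//|/ltnW Nn] := leqP n N.
rewrite -[u n](subrK (u N)) (le_trans (ratpabsD p_pr _ _)) // ge_max small // andbT.
by apply: le_trans (ltW (uN _ _ Nn (leqnn _))) _; rewrite /M; lra.
Qed.

Lemma padic_cauchy_subring : subring_closed cauchy.
Proof.
split.
- apply/padic_cauchyP => e e0; exists 0%N => m n _ _.
  by rewrite subrr ratpabs0.
- move=> u v /padic_cauchyP hu /padic_cauchyP hv; apply/padic_cauchyP => e e0.
  have [N uN] := hu _ e0; have [K vK] := hv _ e0.
  exists (maxn N K) => m n; rewrite !geq_max => /andP[Nm Km] /andP[Nn Kn].
  have -> : (u - v) m - (u - v) n = (u m - u n) + - (v m - v n).
    by rewrite !fctE; ring.
  by rewrite (le_lt_trans (ratpabsD p_pr _ _)) // ratpabsN gt_max uN // vK.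
- move=> u v cu cv; apply/padic_cauchyP => e e0.
  have [A A0 uA] := cauchy_bounded cu; have [B B0 vB] := cauchy_bounded cv.
  move: cu cv => /padic_cauchyP hu /padic_cauchyP hv.
  have [N uN] := hu _ (divr_gt0 e0 B0); have [K vK] := hv _ (divr_gt0 e0 A0).
  exists (maxn N K) => m n; rewrite !geq_max => /andP[Nm Km] /andP[Nn Kn].
  have -> : (u * v) m - (u * v) n = (u m - u n) * v m + u n * (v m - v n).
    by rewrite !fctE; ring.
  rewrite (le_lt_trans (ratpabsD p_pr _ _)) // !ratpabsM // gt_max; apply/andP; split.
    apply: (@le_lt_trans _ _ (`[u m - u n] * B)).
      by rewrite ler_wpM2l // ratpabs_ge0.
    by rewrite -ltr_pdivlMr // uN.
  apply: (@le_lt_trans _ _ (A * `[v m - v n])).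
    by rewrite ler_wpM2r // ratpabs_ge0.
  by rewrite mulrC -ltr_pdivlMr // vK.
Qed.

HB.instance Definition _ :=
  GRing.isSubringClosed.Build (nat -> rat) cauchy padic_cauchy_subring.

Record cauchy_seq := CauchySeq { cseq :> nat -> rat ; _ : cseq \in cauchy }.

HB.instance Definition _ := [isSub for cseq].
HB.instance Definition _ := [Choice of cauchy_seq by <:].
HB.instance Definition _ := [SubChoice_isSubComNzRing of cauchy_seq by <:].

Definition padic_null : {pred cauchy_seq} := fun u =>
  `[< forall e : rat, 0 < e -> exists N, forall n, (N <= n)%N -> `[u n] < e >].

Lemma padic_nullP (u : cauchy_seq) : reflect (forall e : rat, 0 < e ->
  exists N, forall n, (N <= n)%N -> `[u n] < e) (u \in padic_null).
Proof. exact: asboolP. Qed.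

Lemma padic_null_ideal : idealr_closed padic_null.
Proof.
split.
- by apply/padic_nullP => e e0; exists 0%N => n _; rewrite ratpabs0.
- apply/negP => /padic_nullP/(_ 1 ltr01)[N /(_ N (leqnn N))].
  by rewrite ratpabs1 ltxx.
- move=> a u v /padic_nullP hu /padic_nullP hv; apply/padic_nullP => e e0.
  have [A A0 aA] := cauchy_bounded (valP a).
  have [N uN] := hu _ (divr_gt0 e0 A0); have [K vK] := hv _ e0.
  exists (maxn N K) => n; rewrite !geq_max => /andP[Nn Kn].
  have -> : (a * u + v) n = a n * u n + v n by [].
  rewrite (le_lt_trans (ratpabsD p_pr _ _)) // ratpabsM // gt_max vK // andbT.
  apply: (@le_lt_trans _ _ (A * `[u n])).
    by rewrite ler_wpM2r // ratpabs_ge0.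
  by rewrite mulrC -ltr_pdivlMr // uN.
Qed.

HB.instance Definition _ :=
  isIdealr.Build cauchy_seq padic_null padic_null_ideal.

Definition Qp := {ideal_quot padic_null}.

HB.instance Definition _ := GRing.ComNzRing.on Qp.
HB.instance Definition _ := EqQuotient.on Qp.

Definition padic_norm (x : Qp) : rat :=
  lim ((fun n => `[repr x n] : rat^o) @ \oo).

Local Notation "`| x |_p" := (padic_norm x) (format "`| x |_p").

Lemma Qp_eq0 (u : cauchy_seq) : (\pi_Qp u == 0) = (u \in padic_null).
Proof. by rewrite -[X in _ == X]pi_zeror piE /= /Quotient.equiv subr0. Qed.

Lemma notin_null (u : cauchy_seq) : u \notin padic_null ->
  exists c, exists N, forall n, (N <= n)%N -> `[u n] = c.
Proof.
move=> /padic_nullP/existsNP[e /not_implyP[e0 /forallNP uN]].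
have /padic_cauchyP/(_ e e0)[N uC] := valP u.
have /existsNP[n /not_implyP[Nn /negP]] := uN N; rewrite -leNgt => en.
exists `[u n], N => m Nm; apply: ratpabs_eq => //.
exact: lt_le_trans (uC _ _ Nm Nn) en.
Qed.

Lemma padic_norm0 : `|0|_p = 0.
Proof.
have /padic_nullP rN : repr (0 : Qp) \in padic_null by rewrite -Qp_eq0 reprK.
apply: (@cvg_lim rat^o); first exact: norm_hausdorff.
  apply/(@cvgrPdist_lt rat rat^o) => e e0; have [N {}rN] := rN e e0.
by exists N => // n /= Nn; rewrite sub0r normrN ger0_norm ?ratpabs_ge0 ?rN.
Qed.

Lemma padic_normP (u : cauchy_seq) : \pi_Qp u != 0 ->
  exists N, forall n, (N <= n)%N -> `[u n] = `|\pi_Qp u|_p.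
Proof.
move=> u0; set r := repr (\pi_Qp u).
have r0 : r \notin padic_null by rewrite -Qp_eq0 reprK.
have [d [K rd]] := notin_null r0.
have -> : `|\pi_Qp u|_p = d.
  apply: (@cvg_lim rat^o); first exact: norm_hausdorff.
  apply/(@cvgrPdist_lt rat rat^o) => e e0.
  by exists K => // n /= Kn; rewrite rd // subrr normr0.
have d0 : 0 < d.
  have d_ge0 : 0 <= d by rewrite -(rd K) // ratpabs_ge0.
  rewrite lt_neqAle d_ge0 andbT; apply/eqP => dE; move/negP: r0; apply.
  by apply/padic_nullP => e e0; exists K => n Kn; rewrite rd // -dE.
have /padic_nullP/(_ d d0)[N urN] : u - r \in padic_null.
  by rewrite -Qp_eq0 rmorphB /= reprK subrr.
exists (maxn N K) => n; rewrite geq_max => /andP[Nn Kn].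
by rewrite -(rd n) //; apply: ratpabs_eq => //; rewrite rd //; exact: urN.
Qed.

Lemma padic_norm_eq0 (x : Qp) : (`|x|_p == 0) = (x == 0).
Proof.
have [->|] := eqVneq x 0; first by rewrite padic_norm0 eqxx.
rewrite -[x]reprK => x0; have [N xN] := padic_normP x0.
apply/negbTE/eqP => x00; move: x0; rewrite Qp_eq0 => /negP; apply.
by apply/padic_nullP => e e0; exists N => n Nn; rewrite xN // x00.
Qed.

Lemma padic_normE (x : Qp) : x != 0 -> exists k : int, `|x|_p = p%:R ^ k.
Proof.
move=> x0; have : `|x|_p != 0 by rewrite padic_norm_eq0.
move: x0; rewrite -[x]reprK => x0.
have [N /(_ N (leqnn N)) <-] := padic_normP x0.
have [->|u0 _] := eqVneq (repr x N) 0; first by rewrite ratpabs0 eqxx.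
by rewrite /ratpabs (negbTE u0); eexists.
Qed.

Lemma padic_norm_ge0 (x : Qp) : 0 <= `|x|_p.
Proof.
have [->|] := eqVneq x 0; first by rewrite padic_norm0.
by move=> /padic_normE[k ->]; rewrite exprz_ge0.
Qed.

Lemma padic_normM (x y : Qp) : `|x * y|_p = `|x|_p * `|y|_p.
Proof.
have [->|x0] := eqVneq x 0; first by rewrite mul0r padic_norm0 mul0r.
have [->|y0] := eqVneq y 0; first by rewrite mulr0 padic_norm0 mulr0.
move: x0 y0; rewrite -[x]reprK -[y]reprK => x0 y0.
have [N xN] := padic_normP x0; have [K yK] := padic_normP y0.
rewrite -rmorphM /=; have xyE n : (maxn N K <= n)%N ->
    `[(repr x * repr y) n] = `|\pi_Qp (repr x)|_p * `|\pi_Qp (repr y)|_p.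
  by rewrite geq_max => /andP[Nn Kn]; rewrite ratpabsM // xN // yK.
have [xy0|xy0] := eqVneq (\pi_Qp (repr x * repr y)) 0; last first.
  have [M xyM] := padic_normP xy0.
  by rewrite -(xyM (maxn M (maxn N K))) ?leq_maxl // xyE // leq_maxr.
have /padic_nullP xyN : repr x * repr y \in padic_null by rewrite -Qp_eq0 xy0.
have : 0 < `|\pi_Qp (repr x)|_p * `|\pi_Qp (repr y)|_p.
  by rewrite mulr_gt0 // lt_neqAle eq_sym padic_norm_eq0 padic_norm_ge0 ?x0 ?y0.
move=> /[dup] /xyN[M xyM] _.
have := xyM (maxn M (maxn N K)) (leq_maxl _ _).
by rewrite xyE ?leq_maxr // ltxx.
Qed.

Lemma padic_norm1 : `|1|_p = 1.
Proof.
have n0 : `|1|_p != 0 by rewrite padic_norm_eq0 oner_eq0.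
by apply: (mulfI n0); rewrite -padic_normM !mulr1.
Qed.

Lemma padic_normN (x : Qp) : `|- x|_p = `|x|_p.
Proof.
rewrite -mulN1r padic_normM; suff -> : `|-1|_p = 1 by rewrite mul1r.
have : `|-1|_p ^+ 2 = 1 by rewrite expr2 -padic_normM mulrNN mulr1 padic_norm1.
move/eqP; rewrite sqrf_eq1 => /orP[/eqP//|/eqP n1].
by have := padic_norm_ge0 (-1); rewrite n1.
Qed.

Lemma padic_normD (x y : Qp) : `|x + y|_p <= Num.max `|x|_p `|y|_p.
Proof.
have [->|x0] := eqVneq x 0; first by rewrite add0r le_max lexx orbT.
have [->|y0] := eqVneq y 0; first by rewrite addr0 le_max lexx.
have [->|xy0] := eqVneq (x + y) 0.
  by rewrite padic_norm0 le_max padic_norm_ge0.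
move: x0 y0 xy0; rewrite -[x]reprK -[y]reprK -rmorphD /= => x0 y0 xy0.
have [N xN] := padic_normP x0; have [K yK] := padic_normP y0.
have [M xyM] := padic_normP xy0.
pose n := maxn M (maxn N K).
rewrite -(xN n) -?(yK n) -?(xyM n) ?ratpabsD //; rewrite /n; lia.
Qed.

Lemma Qp_mulVP (x : Qp) : exists y, if x == 0 then y = 0 else y * x = 1.
Proof.
have [_|] := eqVneq x 0; first by exists 0.
rewrite -[x]reprK => x0; set u := repr x in x0 *.
have [N uN] := padic_normP x0; set c := `|_|_p in uN.
have c0 : 0 < c by rewrite lt_neqAle eq_sym padic_norm_eq0 x0 padic_norm_ge0.
have uneq0 n : (N <= n)%N -> u n != 0.
  by move=> Nn; rewrite -(ratpabs_eq0 p_pr) uN // gt_eqF.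
pose v : nat -> rat := fun n => (u n)^-1.
have vC : v \in cauchy.
  apply/padic_cauchyP => e e0.
  have ec0 : 0 < e * (c * c) by rewrite !mulr_gt0.
  have /padic_cauchyP/(_ _ ec0)[K uK] := valP u.
  exists (maxn N K) => m n; rewrite !geq_max => /andP[Nm Km] /andP[Nn Kn].
  have -> : v m - v n = (u n - u m) / (u m * u n).
    by rewrite /v; field; rewrite !uneq0.
  rewrite ratpabsM // ratpabsV // ratpabsM // !uN //.
  by rewrite ltr_pdivrMr ?mulr_gt0 // uK.
exists (\pi_Qp (CauchySeq vC)); apply/eqP.
rewrite -subr_eq0 -rmorphM -(rmorph1 \pi_Qp) -rmorphB /= Qp_eq0.
apply/padic_nullP => e e0; exists N => n Nn.
have -> : (CauchySeq vC * u - 1) n = v n * u n - 1 by [].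
by rewrite /v mulVf ?uneq0 // subrr ratpabs0.
Qed.

Definition Qp_inv (x : Qp) : Qp := sval (cid (Qp_mulVP x)).

Lemma Qp_mulVf (x : Qp) : x != 0 -> Qp_inv x * x = 1.
Proof.
by rewrite /Qp_inv; case: cid => y /=; case: eqP. Qed.

Lemma Qp_inv0 : Qp_inv 0 = 0.
Proof. by rewrite /Qp_inv; case: cid => y /=; rewrite eqxx. Qed.

HB.instance Definition _ := GRing.ComNzRing_isField.Build Qp Qp_mulVf Qp_inv0.

Definition padic_dist (x y : Qp) := `|x - y|_p.

Lemma padic_distxx (x : Qp) : padic_dist x x = 0.
Proof. by rewrite /padic_dist subrr padic_norm0. Qed.

Lemma padic_dist_eq0 (x y : Qp) : padic_dist x y = 0 -> x = y.
Proof. by move/eqP; rewrite padic_norm_eq0 subr_eq0 => /eqP. Qed.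

Lemma padic_distC (x y : Qp) : padic_dist x y = padic_dist y x.
Proof. by rewrite /padic_dist -opprB padic_normN. Qed.

Lemma padic_dist_triangle (y x z : Qp) :
  padic_dist x z <= padic_dist x y + padic_dist y z.
Proof.
rewrite /padic_dist; have -> : x - z = (x - y) + (y - z) by ring.
rewrite (le_trans (padic_normD _ _)) // ge_max.
by rewrite lerDl padic_norm_ge0 lerDr padic_norm_ge0.
Qed.

HB.instance Definition _ := isMetric.Build rat Qp
  padic_distxx padic_dist_eq0 padic_distC padic_dist_triangle.

End CauchySequences.

Notation "`| x |_p" := (padic_norm x) (format "`| x |_p") : ring_scope.

Section PadicVectors.
Variables (p : nat) (p_pr : prime p).
Local Notation K := (Qp p_pr).

Lemma padic_norm_ratr (q : rat) : `|ratr q : K|_p = ratpabs p q.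
Proof.
have C (a : rat) : (fun=> a) \in padic_cauchy p_pr.
  by apply/padic_cauchyP => e e0; exists 0%N => m k _ _; rewrite subrr ratpabs0.
pose f (a : rat) : K := \pi_K (CauchySeq (C a)).
have fB : zmod_morphism f.
  by move=> a b; rewrite /f -rmorphB; congr (\pi _); apply: val_inj.
have fM : monoid_morphism f.
  split; first by rewrite /f -(rmorph1 \pi_K); congr (\pi _); apply: val_inj.
  by move=> a b; rewrite /f -rmorphM; congr (\pi _); apply: val_inj.
pose fa := GRing.isZmodMorphism.Build rat K f fB.
pose fm := GRing.isMonoidMorphism.Build rat K f fM.
pose F : {rmorphism rat -> K} := HB.pack f fa fm.
rewrite -(fmorph_eq_rat F); have [->|q0] := eqVneq q 0.
  by rewrite rmorph0 padic_norm0 ratpabs0.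
have Fq0 : \pi_K (CauchySeq (C q)) != 0.
  by rewrite -[X in X != 0]/(F q) fmorph_eq0.
by have [N /(_ N (leqnn N))] := padic_normP Fq0.
Qed.

Variable n : nat.

Definition padic_vnorm (x : 'cV[K]_n) : rat :=
  \big[Num.max/0]_(i < n) `|x i 0|_p.

Lemma padic_vnormZ (a : K) (x : 'cV[K]_n) :
  padic_vnorm (a *: x) = `|a|_p * padic_vnorm x.
Proof.
rewrite /padic_vnorm; elim/big_rec2: _ => [|i y z _ ->]; first by rewrite mulr0.
by rewrite mxE padic_normM maxr_pMr // padic_norm_ge0.
Qed.

Lemma padic_vnormE (x : 'cV[K]_n) : x != 0 ->
  exists k : int, padic_vnorm x = p%:R ^ k.
Proof.
move=> x0; have : padic_vnorm x = 0 \/ exists k : int, padic_vnorm x = p%:R ^ k.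
  rewrite /padic_vnorm; elim/big_ind: _ => [|a b|i _]; first by left.
  - by move=> ha hb; case: (leP a b).
  - have [->|/padic_normE[k ->]] := eqVneq (x i 0) 0; last by right; exists k.
    by left; rewrite padic_norm0.
case=> // nx0; have [i xi0] : exists i, x i 0 != 0.
  apply/existsP; apply: contraNT x0 => /existsPn x0; apply/eqP/matrixP => i j.
  by rewrite ord1 mxE; apply/eqP; rewrite -[_ == _]negbK x0.
have : `|x i 0|_p <= padic_vnorm x by apply: (le_bigmax _ (fun i => `|x i 0|_p)).
by rewrite nx0 le_eqVlt padic_norm_eq0 (negbTE xi0) ltNge padic_norm_ge0.
Qed.

Definition unit_sphere : set 'cV[K]_n := [set x | padic_vnorm x = 1].

(* The norm is a rational number, a power of [p]; [ratr] reads it as the same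
   power of [p] in [Qp]. *)
Definition padic_normalize (x : 'cV[K]_n) : 'cV[K]_n := ratr (padic_vnorm x) *: x.

Lemma padic_normalize_sphere (x : 'cV[K]_n) : x != 0 ->
  padic_normalize x \in unit_sphere.
Proof.
move=> x0; apply/mem_set; rewrite /unit_sphere /= padic_vnormZ padic_norm_ratr.
have [k ->] := padic_vnormE x0.
rewrite ratpabs_p // -expfzDr ?addNr ?expr0z //.
by rewrite pnatr_eq0 -lt0n prime_gt0.
Qed.

Lemma unit_sphere_mul_neq0 (T : 'M[K]_n) (T_unit : T \in unitmx)
  (x : unit_sphere) : T *m set_val x != 0.
Proof.
apply/eqP => Tx0; have x0 : set_val x = 0.
  by rewrite -[LHS](mulKmx T_unit) Tx0 mulmx0.
have /= : unit_sphere (set_val x) by exact: set_valP.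
rewrite /unit_sphere /= x0 -(scale0r (0 : 'cV[K]_n)) padic_vnormZ padic_norm0 mul0r.
by move/esym/eqP; rewrite oner_eq0.
Qed.

Definition sphere_map (T : 'M[K]_n) (T_unit : T \in unitmx)
    (x : unit_sphere) : unit_sphere :=
  exist _ (padic_normalize (T *m set_val x))
    (padic_normalize_sphere (unit_sphere_mul_neq0 T_unit x)).

End PadicVectors.

Definition iterz (X : Type) (f g : X -> X) (k : int) : X -> X :=
  match k with Posz m => iter m f | Negz m => iter m.+1 g end.

(* [psi] is the inverse homeomorphism, so that [iterz phi psi k] is the [k]-th
   iterate of [phi] for every integer [k]. *)
Definition distal (X : topologicalType) (phi : X -> X) : Prop :=
  exists psi : X -> X,
    [/\ cancel phi psi, cancel psi phi, continuous phi, continuous psi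
      & forall x y : X, x <> y ->
        closure [set (iterz phi psi k x, iterz phi psi k y) | k in [set: int]]
          `&` diagonal = set0].

(* Main.v *)
Require Import Defs.
From HB Require Import structures.
From mathcomp Require Import all_boot all_order all_algebra.
From mathcomp Require Import perm generic_quotient ring_quotient.
From mathcomp Require Import all_classical topology.
From mathcomp Require Import zify ring.

Set Implicit Arguments.
Unset Strict Implicit.
Unset Printing Implicit Defensive.

Import Order.TTheory GRing.Theory Num.Theory.
Local Open Scope classical_set_scope.
Local Open Scope quotient_scope.
Local Open Scope ring_scope.

(** For [x <> 0] the linear map [S] is distal iff [inf_k |S^k x| > 0], and the
    sphere map of [T] is distal iff the directions of [T^k x] and [T^k y] stay
    apart for all distinct unit vectors [x] and [y].

    If [bT] is distal then its powers are uniformly bounded: an unbounded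
    backward orbit would yield a unit vector whose forward orbit stays below
    norm 1, and the recurrence of that orbit a nonzero vector whose forward
    orbit approaches 0. Isometry up to constants then keeps directions apart.

    Conversely, scaling [T^n] by the power [|det T|] of [p] gives [S] with
    [|det S| = 1], so that each [S^k] has a column of norm at least 1; if
    [S^k w] were small for a fixed small [w], then [S^k] would bring the
    directions of [e_c] and [e_c + w] together for some [c]. *)

(** * Integer approximation and limits along ultrafilters in the p-adic numbers *)

Section PadicCompactness.
Variables (p : nat) (p_pr : prime p).
Local Notation K := (Qp p_pr).

Lemma constant_cauchy (q : rat) : (fun=> q) \in padic_cauchy p_pr.
Proof.
apply/padic_cauchyP => e e0; exists 0%N => m k _ _.
by rewrite subrr ratpabs0.
Qed.

Let rat_class (q : rat) : K := \pi_K (CauchySeq (constant_cauchy q)).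

Let rat_class_is_zmod_morphism : zmod_morphism rat_class.
Proof.
by move=> a b; rewrite /rat_class -rmorphB; congr (\pi _); apply: val_inj.
Qed.

Let rat_class_is_monoid_morphism : monoid_morphism rat_class.
Proof.
split; first by rewrite /rat_class -(rmorph1 \pi_K); congr (\pi _); apply: val_inj.
by move=> a b; rewrite /rat_class -rmorphM; congr (\pi _); apply: val_inj.
Qed.

(* [ratr] is a canonical morphism only into ordered fields, hence this copy. *)
Definition Qp_of_rat : {rmorphism rat -> K} :=
  HB.pack rat_class
    (GRing.isZmodMorphism.Build rat K rat_class rat_class_is_zmod_morphism)
    (GRing.isMonoidMorphism.Build rat K rat_class rat_class_is_monoid_morphism).

Lemma ratrE (q : rat) : ratr q = Qp_of_rat q.
Proof. by rewrite -(fmorph_eq_rat Qp_of_rat). Qed.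

(** The norm of a nonzero class is attained by all late terms of a representative, so the strict
    Cauchy bound on terms passes to the class. *)
Lemma cauchy_seq_lim (u : cauchy_seq p_pr) (e : rat) : 0 < e ->
  exists N, forall n, (N <= n)%N -> `|\pi_K u - ratr (u n)|_p < e.
Proof.
move=> e0; have /padic_cauchyP/(_ e e0)[N uN] := valP u; exists N => n Nn.
rewrite ratrE -[Qp_of_rat _]/(\pi_K (CauchySeq (constant_cauchy _))) -rmorphB /=; set w := _ - _.
have [->|w0] := eqVneq (\pi_K w) 0; first by rewrite padic_norm0.
have [M wM] := padic_normP w0.
rewrite -(wM (maxn M N)) ?leq_maxl //.
by apply: uN => //; rewrite leq_maxr.
Qed.

Lemma padic_norm_nat_le1 (m : nat) : `|m%:R : K|_p <= 1.
Proof.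
elim: m => [|m IH]; first by rewrite padic_norm0.
by rewrite -natr1 (le_trans (padic_normD _ _)) // ge_max IH padic_norm1 lexx.
Qed.

Lemma padic_norm_int_le1 (m : int) : `|m%:~R : K|_p <= 1.
Proof.
by case: m => m; rewrite ?NegzE ?mulrNz ?padic_normN padic_norm_nat_le1.
Qed.

Lemma p_gt0 : 0 < p%:R :> rat.
Proof. by rewrite ltr0n prime_gt0. Qed.

Lemma padic_norm_pexp (k : int) : `|p%:R ^ k : K|_p = p%:R ^ (- k).
Proof.
rewrite -(ratpabs_p p_pr) -(padic_norm_ratr p_pr); congr (`| _ |_p).
by rewrite ratrE fmorphXz rmorph_nat.
Qed.

Lemma padic_norm_pexpn (s : nat) : `|p%:R ^+ s : K|_p = p%:R ^- s.
Proof. by have := padic_norm_pexp s%:Z; rewrite -exprnN -exprnP. Qed.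

Lemma pexp_small (e : rat) : 0 < e -> exists s : nat, p%:R ^- s < e.
Proof.
move=> e0; pose s := (Num.truncn e^-1).+1.
exists s; rewrite invf_plt ?posrE ?exprn_gt0 ?p_gt0 //.
apply: (@lt_le_trans _ _ s%:R); first by rewrite /s truncnS_gt.
by rewrite -natrX ler_nat ltnW // ltn_expl // prime_gt1.
Qed.

(** A rational [q] close to [x] is p-integral, so its denominator is invertible modulo [p ^ s], and
    [a] is the residue of [q] modulo [p ^ s]. *)
Lemma padic_residue (s : nat) (x : K) : `|x|_p <= 1 ->
  exists2 a : nat, (a < p ^ s)%N & `|x - a%:R|_p <= p%:R ^- s.
Proof.
move=> x1.
have e0 : 0 < p%:R ^- s :> rat by rewrite invr_gt0 exprn_gt0 // p_gt0.
have s1 : p%:R ^- s <= 1 :> rat.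
  by rewrite invf_le1 ?exprn_gt0 ?p_gt0 // exprn_ege1 // ler1n prime_gt0.
have [q xq] : exists q : rat, `|x - ratr q|_p < p%:R ^- s.
  have [N uN] := cauchy_seq_lim (repr x) e0.
  by exists (repr x N); have := uN _ (leqnn N); rewrite reprK.
have q1 : `|ratr q : K|_p <= 1.
  rewrite -[ratr q](subKr x) (le_trans (padic_normD _ _)) // ge_max x1 padic_normN.
  exact: le_trans (ltW xq) s1.
have [q0|q0] := eqVneq q 0.
  exists 0%N; first by rewrite expn_gt0 prime_gt0.
  by move: xq; rewrite q0 ratrE rmorph0 => /ltW.
(* If [p] divided the denominator, it would not divide the numerator, and the norm of [q] would
   exceed 1. *)
have pNd : coprime (p ^ s) `|denq q|.
  apply: coprimeXl; rewrite prime_coprime //; apply/negP => pd.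
  have pNn : ~~ (p %| `|numq q|)%N.
    apply/negP => pn; have := coprime_num_den q; rewrite /coprime => /eqP g1.
    by have := dvdn_gcd p `|numq q| `|denq q|; rewrite pn pd g1 dvdn1; case: eqP p_pr => // ->.
  move: q1; rewrite padic_norm_ratr /ratpabs (negbTE q0).
  rewrite [logn p `|numq q|]lognE p_pr (negbTE pNn) andbF subr0.
  have l0 : (0 < logn p `|denq q|)%N by rewrite logn_gt0 mem_primes p_pr absz_gt0 denq_neq0.
  by rewrite leNgt -exprnP exprn_egt1 ?ltr1n ?prime_gt1 // -lt0n l0.
have : coprimez (p ^ s)%N%:Z (denq q) by rewrite coprimezE absz_nat.
move=> /coprimezP[[u v] /= uv1].
have ps0 : (p ^ s)%N%:Z != 0 by rewrite eqz_nat -lt0n expn_gt0 prime_gt0.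
(* By the Bezout relation [v] inverts [denq q] modulo [p ^ s], so [m] is an integer congruent to
   [q]. *)
pose m := numq q * v; pose t := (m %/ (p ^ s)%N%:Z)%Z.
have [a aE] : exists a : nat, (m %% (p ^ s)%N%:Z)%Z = a%:Z.
  by exists `|(m %% (p ^ s)%N%:Z)%Z|%N; rewrite gez0_abs // modz_ge0.
exists a; first by rewrite -ltz_nat -aE (lt_le_trans (ltz_mod _ ps0)) // normr_nat.
have qE : q - a%:R = p%:R ^+ s * (q * u%:~R + t%:~R).
  have e1 : m%:~R = t%:~R * p%:R ^+ s + a%:R :> rat.
    by rewrite {1}(divz_eq m (p ^ s)%N%:Z) aE intrD intrM -natrX.
  have e2 : u%:~R * p%:R ^+ s + v%:~R * (denq q)%:~R = 1 :> rat.
    by rewrite -[RHS]/(1%:~R) -uv1 intrD !intrM -natrX.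
  have e3 : m%:~R = q * (denq q)%:~R * v%:~R :> rat by rewrite /m intrM numqE.
  have -> : a%:R = q * (denq q)%:~R * v%:~R - t%:~R * p%:R ^+ s.
    by rewrite -e3 e1 addrAC subrr add0r.
  have eq : q = q * (u%:~R * p%:R ^+ s + v%:~R * (denq q)%:~R) by rewrite e2 mulr1.
  by rewrite [X in X - _]eq; ring.
have -> : x - a%:R = (x - ratr q) + ratr (q - a%:R).
  by rewrite !ratrE rmorphB rmorph_nat; ring.
rewrite (le_trans (padic_normD _ _)) // ge_max (ltW xq) /= qE ratrE rmorphM padic_normM.
rewrite rmorphXn rmorph_nat padic_norm_pexpn ler_piMr ?(ltW e0) //.
rewrite rmorphD rmorphM !rmorph_int (le_trans (padic_normD _ _)) // ge_max.
by rewrite padic_normM mulr_ile1 ?padic_norm_ge0 ?padic_norm_int_le1 // -ratrE.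
Qed.

(** Otherwise the complements of the finitely many [A a] would all lie in [U], although their
    intersection is empty. *)
Lemma ultra_finite_union (T : Type) (U : set_system T) (UU : UltraFilter U)
    (m : nat) (A : nat -> set T) :
  (forall t, exists2 a, (a < m)%N & A a t) -> exists2 a, (a < m)%N & U (A a).
Proof.
move=> cov; apply: contrapT => nA.
have UC (k : nat) : (k <= m)%N -> U [set t | forall a, (a < k)%N -> ~ A a t].
  elim: k => [|k IH] km; first by apply: filterS filterT => t _ a.
  have [UAk|UnAk] := in_ultra_setVsetC (A k) UU; first by case: nA; exists k.
  apply: filterS (filterI (IH (ltnW km)) UnAk) => t [H nAk] a.
  by rewrite ltnS leq_eqVlt => /orP[/eqP->|/H].
have [t nAt] := filter_ex (UC m (leqnn m)).
by have [a am] := cov t; exact: nAt.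
Qed.

(** Compactness of the p-adic integers: for each [s] the ultrafilter selects one of the [p ^ s]
    residue classes. Selected sets meet pairwise, so the chosen residues form a Cauchy sequence,
    whose class is the limit. *)
Lemma ultra_lim_unit_ball (T : Type) (U : set_system T) (UU : UltraFilter U)
    (x : T -> K) : (forall t, `|x t|_p <= 1) ->
  exists y, forall e : rat, 0 < e -> U [set t | `|x t - y|_p < e].
Proof.
move=> x1.
have /choice[a Ua] (s : nat) :
    exists a : nat, U [set t | `|x t - a%:R|_p <= p%:R ^- s].
  have [//|a _ Ua] := @ultra_finite_union _ _ UU (p ^ s)%N
    (fun a => [set t | `|x t - a%:R|_p <= p%:R ^- s]); last by exists a.
  by move=> t; exact: padic_residue.
have aC : (fun s => (a s)%:R) \in padic_cauchy p_pr.
  apply/padic_cauchyP => e e0; have [s se] := pexp_small e0.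
  exists s => k l sk sl; have [t /= [tk tl]] := filter_ex (filterI (Ua k) (Ua l)).
  rewrite -(padic_norm_ratr p_pr) ratrE rmorphB !rmorph_nat.
  have -> : (a k)%:R - (a l)%:R = (x t - (a l)%:R) - (x t - (a k)%:R) :> K by ring.
  rewrite (le_lt_trans (padic_normD _ _)) // padic_normN gt_max.
  have pow (i : nat) : (s <= i)%N -> p%:R ^- i <= p%:R ^- s :> rat.
    move=> si; rewrite lef_pV2 ?posrE ?exprn_gt0 ?p_gt0 //.
    by rewrite ler_weXn2l // ler1n prime_gt0.
  by rewrite (le_lt_trans tl) ?(le_lt_trans tk) // (le_lt_trans (pow _ _)).
exists (\pi_K (CauchySeq aC)) => e e0.
have [s se] := pexp_small e0; have [N aN] := cauchy_seq_lim (CauchySeq aC) e0.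
pose k := maxn s N; apply: filterS (Ua k) => t /= tk.
rewrite -[x t](subrK (a k)%:R) -addrA (le_lt_trans (padic_normD _ _)) // gt_max.
apply/andP; split.
  apply: le_lt_trans tk _; apply: le_lt_trans se.
  rewrite lef_pV2 ?posrE ?exprn_gt0 ?p_gt0 // ler_weXn2l ?leq_maxl //.
  by rewrite ler1n prime_gt0.
have := aN k (leq_maxr _ _).
by rewrite ratrE rmorph_nat -padic_normN opprB.
Qed.

Lemma ultra_lim (T : Type) (U : set_system T) (UU : UltraFilter U)
    (C : rat) (x : T -> K) : (forall t, `|x t|_p <= C) ->
  exists y, forall e : rat, 0 < e -> U [set t | `|x t - y|_p < e].
Proof.
move=> xC; have C0 : 0 < Num.max C 1 by rewrite lt_max ltr01 orbT.
(* Multiplication by [p ^ s] brings the whole family into the unit ball; the limit is scaled back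
   afterwards. *)
have [s sC] : exists s : nat, p%:R ^- s < (Num.max C 1)^-1 :> rat.
  by apply: pexp_small; rewrite invr_gt0.
have ps0 : p%:R ^+ s != 0 :> K.
  by rewrite -padic_norm_eq0 padic_norm_pexpn gt_eqF // invr_gt0 exprn_gt0 ?p_gt0.
have Ips : 0 < p%:R ^- s :> rat by rewrite invr_gt0 exprn_gt0 ?p_gt0.
have [|y Uy] := @ultra_lim_unit_ball _ _ UU (fun t => p%:R ^+ s * x t).
  move=> t; have inv1 : (Num.max C 1)^-1 * Num.max C 1 = 1 by rewrite mulVf ?gt_eqF.
  rewrite padic_normM padic_norm_pexpn -[X in _ <= X]inv1.
  apply: ler_pM; [exact: ltW|exact: padic_norm_ge0|exact: ltW|].
  by rewrite (le_trans (xC t)) // le_max lexx.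
exists (p%:R ^- s * y) => e e0.
apply: filterS (Uy (p%:R ^- s * e) (mulr_gt0 Ips e0)) => t /=.
have -> : p%:R ^+ s * x t - y = p%:R ^+ s * (x t - p%:R ^- s * y).
  by rewrite mulrBr mulrA divff // mul1r.
by rewrite padic_normM padic_norm_pexpn ltr_pM2l.
Qed.

End PadicCompactness.

(** * The maximum norm on vectors and its behaviour under matrices *)

Section PadicVectorNorm.
Variables (p : nat) (p_pr : prime p).
Local Notation K := (Qp p_pr).

Lemma padic_norm_sum_le (I : Type) (r : seq I) (P : pred I) (F : I -> K) (C : rat) :
  0 <= C -> (forall i, P i -> `|F i|_p <= C) -> `|\sum_(i <- r | P i) F i|_p <= C.
Proof.
move=> C0 FC; elim/big_ind: _ => [|x y hx hy|//]; first by rewrite padic_norm0.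
by rewrite (le_trans (padic_normD _ _)) // ge_max hx hy.
Qed.

Lemma padic_norm_sum_lt (I : Type) (r : seq I) (P : pred I) (F : I -> K) (C : rat) :
  0 < C -> (forall i, P i -> `|F i|_p < C) -> `|\sum_(i <- r | P i) F i|_p < C.
Proof.
move=> C0 FC; elim/big_ind: _ => [|x y hx hy|//]; first by rewrite padic_norm0.
by rewrite (le_lt_trans (padic_normD _ _)) // gt_max hx hy.
Qed.

Lemma padic_norm_prod (I : Type) (r : seq I) (P : pred I) (F : I -> K) :
  `|\prod_(i <- r | P i) F i|_p = \prod_(i <- r | P i) `|F i|_p.
Proof. by apply: (big_morph _ (@padic_normM _ p_pr)); exact: padic_norm1. Qed.

Section Dimension.
Variable n : nat.
Implicit Types x y : 'cV[K]_n.

Lemma padic_vnorm_ge0 x : 0 <= padic_vnorm x.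
Proof.
rewrite /padic_vnorm; elim/big_ind: _ => // [a b a0 b0|i _].
  by rewrite le_max a0.
exact: padic_norm_ge0.
Qed.

Lemma padic_norm_coord x i : `|x i 0|_p <= padic_vnorm x.
Proof. exact: (le_bigmax _ (fun i => `|x i 0|_p)). Qed.

Lemma padic_vnorm_leP x (r : rat) : 0 <= r ->
  padic_vnorm x <= r <-> forall i, `|x i 0|_p <= r.
Proof.
move=> r0; split=> [xr i|xr]; first exact: le_trans (padic_norm_coord x i) xr.
by apply/bigmax_leP; split=> // i _.
Qed.

Lemma padic_vnorm_ltP x (r : rat) : 0 < r ->
  padic_vnorm x < r <-> forall i, `|x i 0|_p < r.
Proof.
move=> r0; split=> [xr i|xr]; first exact: le_lt_trans (padic_norm_coord x i) xr.
by apply/bigmax_ltP; split=> // i _.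
Qed.

Lemma padic_vnorm0 : padic_vnorm (0 : 'cV[K]_n) = 0.
Proof. by rewrite -(scale0r 0) padic_vnormZ padic_norm0 mul0r. Qed.

Lemma padic_vnorm_eq0 x : (padic_vnorm x == 0) = (x == 0).
Proof.
apply/eqP/eqP => [x0|->]; last exact: padic_vnorm0.
apply/matrixP => i j; rewrite ord1 mxE; apply/eqP.
by rewrite -padic_norm_eq0 eq_le padic_norm_ge0 -x0 padic_norm_coord.
Qed.

Lemma padic_vnorm_gt0 x : (0 < padic_vnorm x) = (x != 0).
Proof. by rewrite lt_neqAle eq_sym padic_vnorm_eq0 padic_vnorm_ge0 andbT. Qed.

Lemma padic_vnormN x : padic_vnorm (- x) = padic_vnorm x.
Proof. by rewrite -scaleN1r padic_vnormZ padic_normN padic_norm1 mul1r. Qed.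

Lemma padic_vnormB x y : padic_vnorm (x - y) = padic_vnorm (y - x).
Proof. by rewrite -opprB padic_vnormN. Qed.

Lemma padic_vnormD x y :
  padic_vnorm (x + y) <= Num.max (padic_vnorm x) (padic_vnorm y).
Proof.
apply/padic_vnorm_leP => [|i]; first by rewrite le_max padic_vnorm_ge0.
rewrite mxE (le_trans (padic_normD _ _)) // ge_max !le_max.
by rewrite !padic_norm_coord orbT.
Qed.

Lemma padic_vnormD_le x y (r : rat) :
  padic_vnorm x <= r -> padic_vnorm y <= r -> padic_vnorm (x + y) <= r.
Proof. by move=> xr yr; rewrite (le_trans (padic_vnormD _ _)) // ge_max xr yr. Qed.

Lemma padic_vnormD_lt x y (r : rat) :
  padic_vnorm x < r -> padic_vnorm y < r -> padic_vnorm (x + y) < r.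
Proof. by move=> xr yr; rewrite (le_lt_trans (padic_vnormD _ _)) // gt_max xr yr. Qed.

(** Triangles are isosceles in an ultrametric space. Hence norms are locally constant away from 0
    and are preserved exactly by the limits below. *)
Lemma padic_vnorm_eq x y : padic_vnorm (x - y) < padic_vnorm y ->
  padic_vnorm x = padic_vnorm y.
Proof.
move=> h; apply/eqP; rewrite eq_le; apply/andP; split.
  by rewrite -[x](subrK y) padic_vnormD_le ?lexx // ltW.
rewrite leNgt; apply/negP => xy.
have : padic_vnorm (x - (x - y)) < padic_vnorm y.
  by apply: padic_vnormD_lt; rewrite ?padic_vnormN.
by rewrite subKr ltxx.
Qed.

Lemma ultra_vlim (T : Type) (U : set_system T) (UU : UltraFilter U)
    (C : rat) (x : T -> 'cV[K]_n) : (forall t, padic_vnorm (x t) <= C) ->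
  exists y, forall e : rat, 0 < e -> U [set t | padic_vnorm (x t - y) < e].
Proof.
move=> xC; have /choice[y Uy] (i : 'I_n) : exists y : K, forall e : rat, 0 < e ->
    U [set t | `|x t i 0 - y|_p < e].
  by apply: (@ultra_lim _ _ _ _ UU C) => t; exact: le_trans (padic_norm_coord _ _) (xC t).
exists (\col_i y i) => e e0.
have : U [set t | forall i : 'I_n, `|x t i 0 - y i|_p < e].
  have UF : Filter U by exact: filter_filter.
  exact: (filter_forall (f := fun i => [set t | `|x t i 0 - y i|_p < e]) UF
    (fun i => Uy i e e0)).
apply: filterS => t /= xy; apply/padic_vnorm_ltP => // i.
by rewrite !mxE.
Qed.

Lemma nbhs_padic_vnormP x (A : set 'cV[K]_n) :
  nbhs x A <-> exists2 e : rat, 0 < e & forall y, padic_vnorm (x - y) < e -> A y.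
Proof.
split.
  move=> /(@nbhs_ballP rat)[e /= e0 eA]; exists e => // y xy; apply: eA.
  split=> // i j; rewrite ord1; have := padic_norm_coord (x - y) i.
  by rewrite !mxE => /le_lt_trans; exact.
move=> [e e0 eA]; apply/(@nbhs_ballP rat); exists e => //= y [_ xy].
apply: eA; apply/padic_vnorm_ltP => // i; rewrite !mxE; exact: xy.
Qed.

End Dimension.

Lemma mulmx_bounded (m n : nat) (A : 'M[K]_(m, n)) :
  exists2 C : rat, 0 < C & forall x, padic_vnorm (A *m x) <= C * padic_vnorm x.
Proof.
(* A crude bound on all entries; the added 1 makes it positive. *)
pose C := \sum_i \sum_j `|A i j|_p + 1.
have S0 i : 0 <= \sum_j `|A i j|_p by rewrite sumr_ge0 // => j _; exact: padic_norm_ge0.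
have SS0 : 0 <= \sum_i \sum_j `|A i j|_p by rewrite sumr_ge0.
exists C; first by rewrite /C ltr_wpDl.
move=> x; have C0 : 0 <= C by rewrite addr_ge0.
apply/padic_vnorm_leP => [|i]; first by rewrite mulr_ge0 ?padic_vnorm_ge0.
rewrite mxE; apply: padic_norm_sum_le => [|j _]; first by rewrite mulr_ge0 ?padic_vnorm_ge0.
rewrite padic_normM ler_pM ?padic_norm_ge0 ?padic_norm_coord //.
rewrite /C (bigD1 i) //= (bigD1 j) //= -!addrA lerDl.
rewrite !addr_ge0 ?sumr_ge0 // => k _; exact: padic_norm_ge0.
Qed.

(** If all columns had norm below 1, so would every term of the Leibniz expansion, and by the
    ultrametric inequality the determinant. *)
Lemma col_vnorm_ge1 (n : nat) (A : 'M[K]_n) : (0 < n)%N -> `|\det A|_p = 1 ->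
  exists c, 1 <= padic_vnorm (col c A).
Proof.
move=> n0 detA; apply: contrapT => /forallNP col_lt1.
suff : `|\det A|_p < 1 by rewrite detA ltxx.
apply: padic_norm_sum_lt => // s _; rewrite padic_normM.
have sgn1 (b : bool) : `|(-1) ^+ b : K|_p = 1.
  by case: b; rewrite ?expr0 ?expr1 ?padic_normN padic_norm1.
rewrite sgn1 mul1r padic_norm_prod.
have A_lt1 i : `|A i ((s : {perm _}) i)|_p < 1.
  have /negP := col_lt1 ((s : {perm _}) i); rewrite -ltNge; apply: le_lt_trans.
  by have := padic_norm_coord (col (s i) A) i; rewrite mxE.
(* As [n] is positive, a factor below 1 can be split off the product; the remaining factors are at
   most 1. *)
case: n n0 A s A_lt1 {detA col_lt1} => // n _ A s A_lt1.
rewrite big_ord_recl; apply: le_lt_trans (A_lt1 ord0).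
rewrite ler_piMr ?padic_norm_ge0 // prodr_ile1 // => i _.
by rewrite padic_norm_ge0 ltW.
Qed.

End PadicVectorNorm.

(** * Normalization of vectors and scalar factors *)

Section Normalization.
Variables (p : nat) (p_pr : prime p) (n : nat).
Local Notation K := (Qp p_pr).
Implicit Types x y : 'cV[K]_n.

(** A power of [p] read as a p-adic scalar has the inverse power as its norm, which is why
    multiplying by it normalizes. *)
Lemma ratr_vnorm_norm x : x != 0 -> `|ratr (padic_vnorm x) : K|_p = (padic_vnorm x)^-1.
Proof.
move=> /padic_vnormE[k ->].
by rewrite padic_norm_ratr ratpabs_p // invr_expz.
Qed.

Lemma padic_vnorm_normalize x : x != 0 -> padic_vnorm (padic_normalize x) = 1.
Proof.
move=> x0; rewrite padic_vnormZ ratr_vnorm_norm // mulVf //.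
by rewrite padic_vnorm_eq0.
Qed.

Lemma padic_normalize_id x : padic_vnorm x = 1 -> padic_normalize x = x.
Proof. by move=> x1; rewrite /padic_normalize x1 ratrE rmorph1 scale1r. Qed.

Lemma padic_normalizeZp (l : int) x :
  padic_normalize (p%:R ^ l *: x) = padic_normalize x.
Proof.
rewrite /padic_normalize padic_vnormZ padic_norm_pexp !ratrE rmorphM fmorphXz.
rewrite rmorph_nat scalerA; congr (_ *: _); rewrite mulrAC -expfzDr ?addNr ?mul1r //.
have := padic_norm_pexp p_pr 1; rewrite -padic_norm_eq0 => ->.
by rewrite gt_eqF // exprz_gt0 // p_gt0.
Qed.

(** For nonzero [a] the scalar on the right has norm 1, so it does not affect distances between
    directions. *)
Lemma padic_normalizeZ (a : K) x :
  padic_normalize (a *: x) = (ratr `|a|_p * a) *: padic_normalize x.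
Proof.
rewrite /padic_normalize padic_vnormZ !ratrE rmorphM !scalerA.
by congr (_ *: _); ring.
Qed.

End Normalization.

(** * Metric separation of orbits and closures meeting the diagonal *)

Section Separation.
Variables (p : nat) (p_pr : prime p) (n : nat).
Local Notation K := (Qp p_pr).
Local Notation V := 'cV[K]_n.

(** The inner normalization multiplies by a power of [p], which the outer one cancels; along an
    orbit it is thus enough to normalize once, at the end. *)
Lemma padic_normalize_mul (m : nat) (A : 'M[K]_(m, n)) (x : V) :
  padic_normalize (A *m padic_normalize x) = padic_normalize (A *m x).
Proof.
have [->|/padic_vnormE[k xk]] := eqVneq x 0; first by rewrite /padic_normalize scaler0.
have -> : padic_normalize x = p%:R ^ k *: x.
  by rewrite /padic_normalize xk ratrE fmorphXz rmorph_nat.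
by rewrite -scalemxAr padic_normalizeZp.
Qed.

(** Metric substitute for the closure condition in [distal]: it implies that condition, and on the
    sphere is implied by it. *)
Definition separated (u v : int -> V) :=
  exists2 e : rat, 0 < e & forall k, e <= padic_vnorm (u k - v k).

Lemma continuous_vnorm_nbhs (X : topologicalType) (f : X -> V) : continuous f ->
  forall a (e : rat), 0 < e -> nbhs a [set z | padic_vnorm (f a - f z) < e].
Proof.
move=> fC a e e0; have /= fB := fC a _ (@nbhsx_ballx rat _ (f a) e e0).
have : nbhs a (f @^-1` ball (f a) e) by exact: fB.
apply: filterS => z [_ /= h].
by apply/padic_vnorm_ltP => // i; rewrite !mxE; exact: h.
Qed.

Lemma mulmx_continuous (A : 'M[K]_n) : continuous (fun x : V => A *m x).
Proof.
move=> x B /(@nbhs_ballP rat)[e /= e0 eB]; apply/(@nbhs_ballP rat).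
have [C C0 AC] := mulmx_bounded A.
exists (e / C); first exact: divr_gt0.
move=> y [_ xy]; apply: eB; split=> // i j; rewrite ord1.
have : padic_vnorm (A *m (x - y)) < e.
  rewrite (le_lt_trans (AC _)) // mulrC -ltr_pdivlMr //.
  apply/padic_vnorm_ltP => [|k]; first exact: divr_gt0.
  by rewrite !mxE; exact: xy.
by move/padic_vnorm_ltP => /(_ e0 i); rewrite mulmxBr !mxE.
Qed.

(** Near a diagonal point [(a, a)] of the closure, [f (u k)] and [f (v k)] would both be within [e]
    of [f a], hence within [e] of each other. *)
Lemma separated_closure (X : topologicalType) (f : X -> V) (u v : int -> X) :
  continuous f -> separated (f \o u) (f \o v) ->
  closure [set (u k, v k) | k in [set: int]] `&` diagonal = set0.
Proof.
move=> fC [e e0 uv]; apply/seteqP; split=> // -[a b] [/= cl].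
rewrite /diagonal /= => ab; rewrite -ab {b ab} in cl.
have aN : nbhs a [set z | padic_vnorm (f a - f z) < e].
  exact: continuous_vnorm_nbhs.
have [] := cl ([set z | padic_vnorm (f a - f z) < e] `*` [set z | padic_vnorm (f a - f z) < e]).
  by exists ([set z | padic_vnorm (f a - f z) < e], [set z | padic_vnorm (f a - f z) < e]).
move=> [_ _] [[k _ [<- <-]] [/= ua va]]; have := uv k; rewrite /= leNgt => /negP; apply.
have -> : f (u k) - f (v k) = (f a - f (v k)) - (f a - f (u k)).
  by rewrite opprB [RHS]addrC addrA subrK.
by apply: padic_vnormD_lt; rewrite ?padic_vnormN.
Qed.

Lemma nbhs_sphereP (x : @unit_sphere p p_pr n) (A : set (@unit_sphere p p_pr n)) :
  nbhs x A -> exists2 e : rat, 0 < e &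
    forall y, padic_vnorm (set_val x - set_val y) < e -> A y.
Proof.
move=> [_ [[B Bo <-] Bx BA]].
have /nbhs_padic_vnormP[e e0 eB] : nbhs (set_val x) B by apply: open_nbhs_nbhs.
by exists e => // y xy; apply: BA; exact: eB.
Qed.

Lemma set_val_sphere_continuous :
  continuous (set_val : @unit_sphere p p_pr n -> V).
Proof. exact: initial_continuous. Qed.

Lemma sphere_vnorm (x : @unit_sphere p p_pr n) : padic_vnorm (set_val x) = 1.
Proof.
by have : unit_sphere (set_val x) by exact: set_valP.
Qed.

Lemma sphere_continuous (g : @unit_sphere p p_pr n -> @unit_sphere p p_pr n) :
  (forall x (e : rat), 0 < e -> exists2 d : rat, 0 < d &
    forall y, padic_vnorm (set_val x - set_val y) < d ->
      padic_vnorm (set_val (g x) - set_val (g y)) < e) ->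
  continuous g.
Proof.
move=> gC x A /nbhs_sphereP[e e0 eA]; have [d d0 dg] := gC x e e0.
have : nbhs x [set y | padic_vnorm (set_val x - set_val y) < d].
  exact: continuous_vnorm_nbhs set_val_sphere_continuous x d d0.
by apply: filterS => y /dg; exact: eA.
Qed.

(** Here compactness of the sphere enters: at times [k t] where the two orbits are closer than
    [p ^- t], a limit point of the first is also one of the second, and gives a diagonal point of
    the closure. *)
Lemma sphere_closure_separated (u v : int -> @unit_sphere p p_pr n) :
  closure [set (u k, v k) | k in [set: int]] `&` diagonal = set0 ->
  separated (set_val \o u) (set_val \o v).
Proof.
move=> cl0; apply: contrapT => nsep.
have /choice[k kP] (t : nat) :
    exists k, padic_vnorm (set_val (u k) - set_val (v k)) < p%:R ^- t.
  apply: contrapT => /forallNP nk; apply: nsep; exists (p%:R ^- t).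
    by rewrite invr_gt0 exprn_gt0 // p_gt0.
  by move=> k; rewrite leNgt; apply/negP/nk.
(* Limits along an ultrafilter finer than the eventual filter replace the choice of a convergent
   subsequence. *)
have [U [UU Usub]] := ultraFilterLemma eventually_filter.
have [|y Uy] := @ultra_vlim p p_pr n _ _ UU 1 (fun t => set_val (u (k t))).
  by move=> t; rewrite sphere_vnorm.
have y1 : padic_vnorm y = 1.
  have [t /= ty] := filter_ex (Uy 1 ltr01).
  by rewrite -(sphere_vnorm (u (k t))); apply: padic_vnorm_eq; rewrite sphere_vnorm padic_vnormB.
pose d : @unit_sphere p p_pr n := exist _ y (mem_set y1).
have : (closure [set (u k, v k) | k in [set: int]] `&` diagonal) (d, d).
  split=> // B [[B1 B2] /= [/nbhs_sphereP[e1 e10 B1e] /nbhs_sphereP[e2 e20 B2e]] BB].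
  pose e := Num.min e1 e2; have e0 : 0 < e by rewrite lt_min e10.
  have [s se] := pexp_small p_pr e0.
  have Us : U [set t | (s <= t)%N] by apply: Usub; exists s.
  have [t [/= ty st]] := filter_ex (filterI (Uy e e0) Us).
  have uvt : padic_vnorm (set_val (u (k t)) - set_val (v (k t))) < e.
    apply: lt_trans (kP t) (le_lt_trans _ se).
    by rewrite lef_pV2 ?posrE ?exprn_gt0 ?p_gt0 // ler_weXn2l // ler1n prime_gt0.
  exists (u (k t), v (k t)); split; first by exists (k t).
  apply: BB; split=> /=.
    by apply: B1e; rewrite padic_vnormB (lt_le_trans ty) // ge_min lexx.
  apply: B2e; apply: (@lt_le_trans _ _ e); last by rewrite ge_min lexx orbT.
  have -> : set_val d - set_val (v (k t)) =
      (set_val (u (k t)) - set_val (v (k t))) - (set_val (u (k t)) - y).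
    by rewrite opprB [RHS]addrC addrA subrK.
  by apply: padic_vnormD_lt; rewrite ?padic_vnormN.
by rewrite cl0.
Qed.

End Separation.

(** * Iterates of linear and sphere maps, and distality in terms of norms *)

Section Iterates.
Variables (p : nat) (p_pr : prime p) (n' : nat).
Local Notation K := (Qp p_pr).
Local Notation n := n'.+1.
Local Notation V := 'cV[K]_n.

Lemma padic_vnorm_normalizeB (x y : V) : x != 0 -> padic_vnorm x = padic_vnorm y ->
  padic_vnorm (padic_normalize x - padic_normalize y) = padic_vnorm (x - y) / padic_vnorm x.
Proof.
move=> x0 xy; rewrite /padic_normalize -xy -scalerBr padic_vnormZ mulrC.
by rewrite ratr_vnorm_norm.
Qed.

Lemma normalize_mulmx_continuous (A : 'M[K]_n) (x : V) (e : rat) :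
  A *m x != 0 -> 0 < e -> exists2 d : rat, 0 < d &
    forall y, padic_vnorm (x - y) < d ->
      padic_vnorm (padic_normalize (A *m x) - padic_normalize (A *m y)) < e.
Proof.
move=> Ax0 e0; have [C C0 AC] := mulmx_bounded A.
have r0 : 0 < padic_vnorm (A *m x) by rewrite padic_vnorm_gt0.
(* The first bound on [m] forces [A *m x] and [A *m y] to have equal norms, hence the same
   normalizing scalar; the second yields the distance [e]. *)
have [m m0 [mr me]] : exists2 m : rat, 0 < m &
    m <= padic_vnorm (A *m x) /\ m <= e * padic_vnorm (A *m x).
  exists (Num.min 1 e * padic_vnorm (A *m x)).
    by rewrite mulr_gt0 // lt_min ltr01.
  by rewrite ler_piMl ?ler_wpM2r ?padic_vnorm_ge0 // ge_min lexx ?orbT.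
exists (m / C); first exact: divr_gt0.
move=> y; rewrite (ltr_pdivlMr _ _ C0) mulrC => /(le_lt_trans (AC (x - y))) xym.
rewrite mulmxBr in xym.
have xyr := lt_le_trans xym mr; have xye := lt_le_trans xym me.
rewrite padic_vnorm_normalizeB // ?ltr_pdivrMr //.
by apply/esym/padic_vnorm_eq; rewrite padic_vnormB.
Qed.

Lemma exprz_mulmxD (S : 'M[K]_n) (k l : int) (x : V) : S \is a GRing.unit ->
  S ^ (k + l) *m x = S ^ k *m (S ^ l *m x).
Proof. by move=> Su; rewrite exprzDr // mulmxA mulmxE. Qed.

Lemma exprz_mulmx_neq0 (S : 'M[K]_n) (k : int) (x : V) : S \is a GRing.unit ->
  x != 0 -> S ^ k *m x != 0.
Proof.
move=> Su; apply: contraNneq => Skx.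
by rewrite -[x]mul1mx -[1%:M]/(S ^ 0) -(addNr k) exprz_mulmxD // Skx mulmx0.
Qed.

(** [distal] provides the inverse only existentially, so [psi] is arbitrary; being a right inverse,
    it is multiplication by the inverse of [S]. *)
Lemma iterz_mulmx (S : 'M[K]_n) (psi : V -> V) (k : int) (x : V) :
  S \is a GRing.unit -> cancel psi (fun x => S *m x) ->
  iterz (fun x => S *m x) psi k x = S ^ k *m x.
Proof.
move=> Su psiK; have psiE y : psi y = S ^ (-1) *m y.
  by rewrite -{2}[y]psiK -[S *m _]/(S ^ 1 *m _) -exprz_mulmxD // addNr mul1mx.
case: k => m /=; first elim: m => [|m IH] /=; first by rewrite mul1mx.
  by rewrite IH intS exprz_mulmxD.
elim: m => [|m IH]; first by rewrite /= psiE.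
have -> : Negz m.+1 = -1 + Negz m by lia.
by rewrite exprz_mulmxD // iterS IH psiE.
Qed.

Lemma set_val_sphere_map (T : 'M[K]_n) (Tu : T \in unitmx) x :
  set_val (sphere_map Tu x) = padic_normalize (T *m set_val x).
Proof. by []. Qed.

Lemma iterz_sphere_map (T : 'M[K]_n) (Tu : T \in unitmx)
    (psi : @unit_sphere p p_pr n -> @unit_sphere p p_pr n) (k : int) x :
  cancel psi (sphere_map Tu) ->
  set_val (iterz (sphere_map Tu) psi k x) = padic_normalize (T ^ k *m set_val x).
Proof.
move=> psiK; have Tu' : T \is a GRing.unit by [].
have psiE y : set_val (psi y) = padic_normalize (T ^ (-1) *m set_val y).
  rewrite -{2}[y]psiK set_val_sphere_map padic_normalize_mul.
  rewrite -[T *m _]/(T ^ 1 *m _) -exprz_mulmxD // addNr mul1mx.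
  by rewrite padic_normalize_id // sphere_vnorm.
case: k => m; rewrite /iterz.
  elim: m => [|m IH]; first by rewrite mul1mx padic_normalize_id // sphere_vnorm.
  by rewrite iterS set_val_sphere_map IH padic_normalize_mul intS exprz_mulmxD.
elim: m => [|m IH]; first exact: psiE.
have -> : Negz m.+1 = -1 + Negz m by lia.
by rewrite (exprz_mulmxD _ _ _ Tu') iterS psiE IH padic_normalize_mul.
Qed.

(** By linearity the pair [x], [y] behaves like [x - y], [0], and an orbit coming arbitrarily close
    to 0 puts [(0, 0)] into the closure. *)
Lemma distal_mulmxP (S : 'M[K]_n) : S \is a GRing.unit ->
  distal (fun x : V => S *m x) <->
  (forall x, x != 0 -> exists2 e : rat, 0 < e & forall k : int, e <= padic_vnorm (S ^ k *m x)).
Proof.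
move=> Su; split=> [[psi [K1 K2 C1 C2 D]] x x0|D].
  apply: contrapT => nx.
  have : (closure [set (iterz (mulmx S) psi k x, iterz (mulmx S) psi k 0) | k in [set: int]]
      `&` diagonal) ((0, 0) : V * V); last first.
    by rewrite D //; apply/eqP.
  split=> // B [[B1 B2] /= [/nbhs_padic_vnormP[e e0 eB] B20] BB].
  have [k ke] : exists k, padic_vnorm (S ^ k *m x) < e.
    apply: contrapT => /forallNP nk; apply: nx; exists e => // k.
    by rewrite leNgt; apply/negP/nk.
  exists (S ^ k *m x, 0); split.
    by exists k => //; rewrite !iterz_mulmx ?mulmx0.
  apply: BB; split=> /=; last exact: nbhs_singleton B20.
  by apply: eB; rewrite sub0r padic_vnormN.
have SK : cancel (fun x : V => S *m x) (fun x => S^-1 *m x).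
  by move=> x; rewrite mulmxA mulmxE mulVr // mul1mx.
have SK' : cancel (fun x : V => S^-1 *m x) (fun x => S *m x).
  by move=> x; rewrite mulmxA mulmxE mulrV // mul1mx.
exists (fun x => S^-1 *m x); split=> //; try exact: mulmx_continuous.
move=> x y /eqP xy; apply: (@separated_closure _ _ _ _ idfun) => [z //|].
have [|e e0 eD] := D (x - y); first by rewrite subr_eq0.
by exists e => // k /=; rewrite !iterz_mulmx // -mulmxBr.
Qed.

Lemma distal_sphere_mapP (T : 'M[K]_n) (Tu : T \in unitmx) :
  distal (sphere_map Tu) <->
  (forall x y : V, padic_vnorm x = 1 -> padic_vnorm y = 1 -> x != y ->
    separated (fun k => padic_normalize (T ^ k *m x)) (fun k => padic_normalize (T ^ k *m y))).
Proof.
split=> [[psi [K1 K2 C1 C2 D]] x y x1 y1 xy|D].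
  pose x' : @unit_sphere p p_pr n := exist _ x (mem_set x1).
  pose y' : @unit_sphere p p_pr n := exist _ y (mem_set y1).
  have xy' : x' <> y' by move/(congr1 set_val) => /= /eqP; apply/negP.
  have [e e0 eD] := sphere_closure_separated (D _ _ xy').
  exists e; first done.
  move=> k; have {}eD : e <= padic_vnorm
    (set_val (iterz (sphere_map Tu) psi k x') - set_val (iterz (sphere_map Tu) psi k y')).
    exact: eD.
  by move: eD; rewrite !(iterz_sphere_map k _ K2).
have T'u : invmx T \in unitmx by rewrite unitmx_inv.
have sphereK (A B : 'M[K]_n) (Au : A \in unitmx) (Bu : B \in unitmx) :
    B *m A = 1%:M -> cancel (sphere_map Au) (sphere_map Bu).
  move=> BA x; apply: val_inj.
  rewrite /= padic_normalize_mul mulmxA BA mul1mx.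
  by rewrite padic_normalize_id // sphere_vnorm.
have K2 := sphereK _ _ T'u Tu (mulmxV Tu).
have scont (A : 'M[K]_n) (Au : A \in unitmx) : continuous (sphere_map Au).
  apply: sphere_continuous => x e e0.
  have [d d0 dP] := normalize_mulmx_continuous (unit_sphere_mul_neq0 Au x) e0.
  by exists d => // y; exact: dP.
exists (sphere_map T'u); split=> //.
  exact: (sphereK _ _ Tu T'u (mulVmx Tu)).
move=> x y xy; apply: (@separated_closure _ _ _ _ set_val).
  exact: set_val_sphere_continuous.
have [|||e e0 eD] := D (set_val x) (set_val y); rewrite ?sphere_vnorm //.
  by apply/eqP => xyE; apply: xy; exact: val_inj.
exists e; first done.
move=> k; rewrite /comp !(iterz_sphere_map k _ K2).
exact: eD.
Qed.

End Iterates.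

(** * Orbits stay away from 0 when the determinant has norm 1 *)

Section DeterminantOne.
Variables (p : nat) (p_pr : prime p) (n' : nat).
Local Notation K := (Qp p_pr).
Local Notation n := n'.+1.
Local Notation V := 'cV[K]_n.

Lemma padic_normX (a : K) (m : nat) : `|a ^+ m|_p = `|a|_p ^+ m.
Proof.
by elim: m => [|m IH]; rewrite ?padic_norm1 // !exprS padic_normM IH.
Qed.

Lemma padic_norm_detX (S : 'M[K]_n) (m : nat) :
  `|\det (S ^+ m)|_p = `|\det S|_p ^+ m.
Proof.
elim: m => [|m IH]; first by rewrite !expr0 det1 padic_norm1.
by rewrite !exprS det_mulmx padic_normM IH.
Qed.

Lemma padic_norm_det_exprz (S : 'M[K]_n) (k : int) :
  `|\det S|_p = 1 -> `|\det (S ^ k)|_p = 1.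
Proof.
move=> S1; have Sn (m : nat) : `|\det (S ^+ m)|_p = 1.
  by rewrite padic_norm_detX S1 expr1n.
case: k => m; first exact: Sn.
rewrite NegzE -exprnN -[(_ ^+ _)^-1]/(invmx _) det_inv.
have := congr1 (fun x => `|x|_p) (mulVf (_ : \det (S ^+ m.+1) != 0)).
rewrite padic_normM Sn mulr1 padic_norm1; apply.
by rewrite -padic_norm_eq0 Sn oner_eq0.
Qed.

Lemma scaler_exprz (a : K) (S : 'M[K]_n) (k : int) :
  a != 0 -> S \is a GRing.unit -> (a *: S) ^ k = a ^ k *: S ^ k.
Proof.
move=> a0 Su; case: k => m; first exact: exprZn.
have am_unit : a ^+ m.+1 \is a GRing.unit by rewrite unitfE expf_neq0.
change (((a *: S) ^+ m.+1)^-1 = a ^- m.+1 *: S ^- m.+1).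
by rewrite exprZn (invrZ am_unit (unitrX m.+1 Su)).
Qed.

Lemma exists_pos_min (I : finType) (f : I -> rat) : (forall i, 0 < f i) ->
  exists2 e : rat, 0 < e & forall i, e <= f i.
Proof.
move=> f0; exists (\big[Num.min/1]_i f i); last by move=> i; apply: bigmin_le_cond.
by elim/big_ind: _ => // a b a0 b0; rewrite lt_min a0.
Qed.

Lemma delta_vnorm (c : 'I_n) : padic_vnorm (delta_mx c 0 : V) = 1.
Proof.
apply/eqP; rewrite eq_le; apply/andP; split.
  apply/padic_vnorm_leP => // i; rewrite mxE eqxx andbT.
  by case: (i == c); rewrite ?padic_norm0 ?padic_norm1.
by have := padic_norm_coord (delta_mx c 0 : V) c; rewrite mxE !eqxx padic_norm1.
Qed.

(* Comparing a basis vector [e_c] with [e_c + w] for small [w]: as long as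
   [S ^ k] shrinks [w] it changes the direction of [S ^ k e_c] by at most
   [|S ^ k w|], because some column of [S ^ k] has norm at least 1. *)
Lemma det1_orbit_bound (S : 'M[K]_n) : S \is a GRing.unit -> `|\det S|_p = 1 ->
  (forall x y : V, padic_vnorm x = 1 -> padic_vnorm y = 1 -> x != y ->
    separated (fun k => padic_normalize (S ^ k *m x)) (fun k => padic_normalize (S ^ k *m y))) ->
  forall x : V, x != 0 ->
    exists2 e : rat, 0 < e & forall k : int, e <= padic_vnorm (S ^ k *m x).
Proof.
move=> Su S1 sep x x0; have x_gt0 : 0 < padic_vnorm x by rewrite padic_vnorm_gt0.
(* With this [s] the multiple [w] of [x] has norm below 1, so every [e_c + w] is again a unit
   vector. *)
have [s sx] : exists s : nat, p%:R ^- s < (padic_vnorm x)^-1 :> rat.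
  by apply: pexp_small => //; rewrite invr_gt0.
pose a : K := p%:R ^+ s; pose w := a *: x.
have a_gt0 : 0 < `|a|_p by rewrite padic_norm_pexpn invr_gt0 exprn_gt0 ?p_gt0.
have w1 : padic_vnorm w < 1.
  by rewrite padic_vnormZ -ltr_pdivlMr // mul1r padic_norm_pexpn.
have w0 : w != 0 by rewrite scaler_eq0 (negbTE x0) orbF -padic_norm_eq0 gt_eqF.
have ew1 c : padic_vnorm (delta_mx c 0 + w) = 1.
  by rewrite -(delta_vnorm c); apply: padic_vnorm_eq; rewrite addrAC subrr add0r delta_vnorm.
have /choice[f fP] (c : 'I_n) : exists e : rat, 0 < e /\ forall k : int,
    e <= padic_vnorm (padic_normalize (S ^ k *m delta_mx c 0)
                      - padic_normalize (S ^ k *m (delta_mx c 0 + w))).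
  have [|e e0 eP] := sep _ _ (delta_vnorm c) (ew1 c); last by exists e.
  by rewrite -subr_eq0 opprD addrA subrr sub0r oppr_eq0.
(* The column [c] used below depends on [k], so one constant must serve all columns. *)
have [e' e'0 e'P] := exists_pos_min (fun c => (fP c).1).
(* The cap 1 ensures that [S ^ k *m w], when shorter than [e], is shorter than the long column too
   and leaves its norm unchanged. *)
pose e := Num.min e' 1; have e_gt0 : 0 < e by rewrite lt_min e'0 ltr01.
exists (e / `|a|_p); first exact: divr_gt0.
move=> k; rewrite ler_pdivrMr // mulrC -padic_vnormZ scalemxAr -/w leNgt.
apply/negP => kw; have kw1 : padic_vnorm (S ^ k *m w) < 1.
  by apply: lt_le_trans kw _; rewrite ge_min lexx orbT.
have [c] := col_vnorm_ge1 (ltn0Sn n') (padic_norm_det_exprz k S1).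
rewrite colE => c1; have := le_trans (e'P c) ((fP c).2 k).
set u := S ^ k *m delta_mx c 0 in c1 *; rewrite mulmxDr -/u.
have u_gt0 : 0 < padic_vnorm u by exact: lt_le_trans ltr01 c1.
have uw : padic_vnorm u = padic_vnorm (u + S ^ k *m w).
  apply/esym/padic_vnorm_eq; rewrite addrAC subrr add0r.
  exact: lt_le_trans kw1 c1.
rewrite padic_vnorm_normalizeB -?padic_vnorm_gt0 //.
rewrite opprD addrA subrr sub0r padic_vnormN leNgt => /negP; apply.
rewrite ltr_pdivrMr //; apply: lt_le_trans kw _.
apply: (@le_trans _ _ e'); first by rewrite ge_min lexx.
by rewrite ler_peMr // ltW.
Qed.

End DeterminantOne.

(** * Backward orbits are bounded when forward orbits stay away from 0 *)

Section BoundedOrbits.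
Variables (p : nat) (p_pr : prime p) (n' : nat).
Local Notation K := (Qp p_pr).
Local Notation n := n'.+1.
Local Notation V := 'cV[K]_n.

(** The least index whose value exceeds the sum of the first [N + 1] terms lies beyond [N] and is a
    strict record by minimality. *)
Lemma unbounded_records (u : nat -> rat) : (forall j, 0 <= u j) ->
  (forall C : rat, exists k, C < u k) ->
  forall N, exists2 k, (N < k)%N & forall j, (j < k)%N -> u j < u k.
Proof.
move=> u0 unb N; pose C := \sum_(i < N.+1) u i.
have uC j : (j <= N)%N -> u j <= C.
  move=> jN; rewrite /C (bigD1 (inord j)) //= inordK // lerDl.
  by rewrite sumr_ge0.
have exC : exists k, C < u k by exact: unb.
case: (ex_minnP exC) => k Ck kmin; exists k.
  by rewrite ltnNge; apply/negP => /uC; rewrite leNgt Ck.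
move=> j jk; apply: le_lt_trans Ck; rewrite leNgt; apply/negP => /kmin.
by rewrite leqNgt jk.
Qed.

(** Modulo the minimal polynomial, of degree [d], every power of [R] is a combination of the first
    [d] powers; [B] thus spans the forward orbit of [y]. *)
Lemma mulmx_expr_span (R : 'M[K]_n) (y : V) : exists d : nat,
  let B := \matrix_(i < n, j < d) (R ^+ j *m y) i 0 in
  forall k : nat, exists c : 'cV[K]_d, R ^+ k *m y = B *m c.
Proof.
exists (degree_mxminpoly R) => B k.
have /mx_inv_hornerK <- : (R ^+ k \in powers_mx R (degree_mxminpoly R))%MS.
  have := horner_mx_mem R ('X^k); rewrite rmorphXn /= horner_mx_X; exact.
rewrite /mx_inv_horner; set c := _ *m pinvmx _.
exists (c^T); rewrite horner_rVpoly mulmx_sum_row linear_sum /= mulmx_suml.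
apply/colP => i; rewrite summxE [RHS]mxE; apply: eq_bigr => j _.
by rewrite linearZ /= rowK mxvecK -scalemxAl !mxE mulrC.
Qed.

(* Successive record times of the unbounded backward orbit of [v]: the
   normalized points reached there have a limit whose forward orbit never
   again reaches norm 1. *)
Lemma unbounded_backward_orbit (R : 'M[K]_n) (v : V) : R \is a GRing.unit ->
  (forall C : rat, exists k : nat, C < padic_vnorm (R ^ (- k%:Z) *m v)) ->
  exists2 y : V, padic_vnorm y = 1 &
    forall j : nat, (0 < j)%N -> padic_vnorm (R ^+ j *m y) < 1.
Proof.
move=> Ru unb; pose u k := R ^ (- k%:Z) *m v.
have [] := @choice _ _ (fun N k => (N < k)%N /\ forall j, (j < k)%N -> padic_vnorm (u j) < padic_vnorm (u k)).
  move=> N; have [||k Nk kP] := @unbounded_records (fun k => padic_vnorm (u k)) _ _ N.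
  - by move=> j; exact: padic_vnorm_ge0.
  - exact: unb.
  - by exists k.
move=> k kP.
have uk_gt0 N : 0 < padic_vnorm (u (k N)).
  have [Nk kr] := kP N.
  by apply: le_lt_trans (kr 0%N _); [exact: padic_vnorm_ge0|exact: leq_ltn_trans Nk].
have ukn0 N : u (k N) != 0 by rewrite -padic_vnorm_gt0.
pose y N := padic_normalize (u (k N)).
have y1 N : padic_vnorm (y N) = 1 by exact: padic_vnorm_normalize.
(* [R ^+ j] leads from [u (k N)] to [u (k N - j)], which is strictly shorter because [k N] is a
   record time. *)
have Ry N j : (0 < j)%N -> (j <= N)%N -> padic_vnorm (R ^+ j *m y N) < 1.
  move=> j0 jN; have [Nk kr] := kP N.
  have jk : (j <= k N)%N by rewrite (leq_trans jN) // ltnW.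
  have RuE : R ^+ j *m u (k N) = u (k N - j)%N.
    rewrite -[R ^+ j *m _]/(R ^ j%:Z *m _) -(exprz_mulmxD _ _ _ Ru) /u.
    by rewrite (_ : j%:Z + - (k N)%:Z = - (k N - j)%N%:Z) //; lia.
  rewrite -scalemxAr RuE padic_vnormZ ratr_vnorm_norm // mulrC.
  by rewrite ltr_pdivrMr // mul1r kr //; lia.
have [U [UU Usub]] := ultraFilterLemma eventually_filter.
have [|z Uz] := @ultra_vlim p p_pr n _ _ UU 1 y; first by move=> t; rewrite y1.
exists z.
  have [t /= tz] := filter_ex (Uz 1 ltr01).
  by rewrite -(y1 t); apply: padic_vnorm_eq; rewrite y1 padic_vnormB.
move=> j j0; have [C C0 RC] := mulmx_bounded (R ^+ j).
have Uj : U [set t | (j <= t)%N] by apply: Usub; exists j.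
have Ci : 0 < C^-1 by rewrite invr_gt0.
have [t /= [tz jt]] := filter_ex (filterI (Uz _ Ci) Uj).
(* The strict bound survives the limit: [R ^+ j] maps [y t - z] to norm below 1 as well. *)
have -> : z = y t - (y t - z) by rewrite subKr.
rewrite mulmxBr; apply: padic_vnormD_lt; first exact: Ry.
rewrite padic_vnormN; apply: le_lt_trans (RC _) _.
by rewrite mulrC -ltr_pdivlMr // mul1r.
Qed.

(* On the span [W] of the forward orbit of the point [y] above the powers
   [R ^+ i] are uniformly bounded. The recurrence of that orbit provides
   [z_s = R ^+ (j s - i s) y - y] in [W] of norm 1 with [R ^+ (i s) z_s -> 0];
   a limit of the [z_s] is a nonzero vector approaching 0. *)
Lemma backward_orbit_bounded (R : 'M[K]_n) (v : V) : R \is a GRing.unit ->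
  (forall x : V, x != 0 ->
    exists2 e : rat, 0 < e & forall k : nat, e <= padic_vnorm (R ^+ k *m x)) ->
  exists C : rat, forall k : nat, padic_vnorm (R ^ (- k%:Z) *m v) <= C.
Proof.
move=> Ru bnd; apply: contrapT => /forallNP unb.
have [|y y1 Ry] := unbounded_backward_orbit (v := v) Ru.
  move=> C; have /existsNP[k /negP kC] := unb C.
  by exists k; rewrite ltNge.
have Ry1 j : padic_vnorm (R ^+ j *m y) <= 1.
  by case: j => [|j]; [rewrite mul1mx y1|rewrite ltW // Ry].
have [d span] := mulmx_expr_span R y.
set B := \matrix_(i, j) _ in span.
have RB i (c : 'cV[K]_d) : padic_vnorm (R ^+ i *m (B *m c)) <= padic_vnorm c.
  have -> : R ^+ i *m (B *m c) = \sum_j c j 0 *: (R ^+ (i + j) *m y).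
    rewrite mulmxA; apply/colP => l; rewrite mxE summxE; apply: eq_bigr => j _.
    rewrite [RHS]mxE mulrC; congr (_ * _).
    rewrite exprD -mulmxE -mulmxA !mxE; apply: eq_bigr => q _.
    by rewrite !mxE.
  elim/big_ind: _ => [|a b ha hb|j _].
  - by rewrite padic_vnorm0 padic_vnorm_ge0.
  - exact: padic_vnormD_le.
  rewrite padic_vnormZ -[X in _ <= X]mulr1.
  by rewrite ler_pM ?padic_norm_ge0 ?padic_vnorm_ge0 ?padic_norm_coord.
(* A generalized inverse of [B], giving vectors of the span coordinates bounded in terms of their
   norm. *)
pose P := (pinvmx B^T)^T.
have BPB : B *m P *m B = B.
  by apply: trmx_inj; rewrite !trmx_mul trmxK mulmxA mulmxKpV.
have [C C0 PC] := mulmx_bounded P.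
have [U [UU Usub]] := ultraFilterLemma eventually_filter.
have [|q Uq] := @ultra_vlim p p_pr n _ _ UU 1 (fun t => R ^+ t *m y).
  exact: Ry1.
have ps0 s : 0 < p%:R ^- s :> rat by rewrite invr_gt0 exprn_gt0 // p_gt0.
have /choice[z zP] (s : nat) : exists z : V, [/\ padic_vnorm z = 1,
    (exists c, z = B *m c) & exists i : nat, padic_vnorm (R ^+ i *m z) < p%:R ^- s].
  have [i /= iq] := filter_ex (Uq _ (ps0 s)).
  have Ui : U [set t | (i < t)%N] by apply: Usub; exists i.+1.
  have [j /= [jq ij]] := filter_ex (filterI (Uq _ (ps0 s)) Ui).
  (* The norm is 1 because [R ^+ (j - i) *m y] is shorter than the unit vector [y]. *)
  exists (R ^+ (j - i) *m y - y); split.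
  - rewrite -y1 -[X in _ = X]padic_vnormN; apply: padic_vnorm_eq.
    by rewrite opprK subrK padic_vnormN y1 Ry // subn_gt0.
  - have [c cE] := span (j - i)%N; have [c0 c0E] := span 0%N.
    by exists (c - c0); rewrite mulmxBr -cE -c0E mul1mx.
  - exists i; rewrite mulmxBr mulmxA mulmxE -exprD subnKC; last exact: ltnW.
    have -> : R ^+ j *m y - R ^+ i *m y = (R ^+ j *m y - q) - (R ^+ i *m y - q).
      by rewrite opprB addrA subrK.
    apply: padic_vnormD_lt; first exact: jq.
    rewrite padic_vnormN; exact: iq.
pose c s := P *m z s.
have Bc s : B *m c s = z s.
  by have [_ [c' zE] _] := zP s; rewrite /c zE !mulmxA BPB.
(* The limit is taken in coordinates so that it stays in the span, where [RB] controls all [R ^+ i]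
   at once. *)
have [|cl Ucl] := @ultra_vlim p p_pr d _ _ UU C c.
  by move=> s; have [z1 _ _] := zP s; rewrite (le_trans (PC _)) // z1 mulr1.
have zl1 : padic_vnorm (B *m cl) = 1.
  have [s /= scl] := filter_ex (Ucl 1 ltr01); have [z1 _ _] := zP s.
  rewrite -z1; apply: padic_vnorm_eq; rewrite z1 -Bc padic_vnormB -mulmxBr.
  have := RB 0%N (c s - cl); rewrite mul1mx => /le_lt_trans; exact.
have [|e e0 eP] := bnd (B *m cl); first by rewrite -padic_vnorm_gt0 zl1.
have [s0 s0e] := pexp_small p_pr e0.
have Us : U [set t | (s0 <= t)%N] by apply: Usub; exists s0.
have [s /= [scl s0s]] := filter_ex (filterI (Ucl e e0) Us).
have [_ _ [i iz]] := zP s; have := eP i; rewrite leNgt => /negP; apply.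
have -> : B *m cl = z s - B *m (c s - cl) by rewrite mulmxBr Bc subKr.
rewrite mulmxBr; apply: padic_vnormD_lt.
  apply: lt_trans iz (le_lt_trans _ s0e).
  by rewrite lef_pV2 ?posrE ?exprn_gt0 ?p_gt0 // ler_weXn2l // ler1n prime_gt0.
rewrite padic_vnormN; exact: le_lt_trans (RB _ _) scl.
Qed.

End BoundedOrbits.

(** * Passing between linear distality and distality on the sphere *)

Section ProjectiveDistality.
Variables (p : nat) (p_pr : prime p) (n' : nat).
Local Notation K := (Qp p_pr).
Local Notation n := n'.+1.
Local Notation V := 'cV[K]_n.

(** The one-sided bound is applied to [S] for negative exponents and to its inverse for the
    others. *)
Lemma orbits_bounded (S : 'M[K]_n) (v : V) : S \is a GRing.unit ->
  (forall x : V, x != 0 ->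
    exists2 e : rat, 0 < e & forall k : int, e <= padic_vnorm (S ^ k *m x)) ->
  exists C : rat, forall k : int, padic_vnorm (S ^ k *m v) <= C.
Proof.
move=> Su bnd; have Siu : S^-1 \is a GRing.unit by rewrite unitrV.
have [|C CP] := backward_orbit_bounded v Su.
  by move=> x /bnd[e e0 eP]; exists e => // k; exact: (eP k%:Z).
have [|C' CP'] := backward_orbit_bounded v Siu.
  move=> x /bnd[e e0 eP]; exists e; first done.
  by move=> k; rewrite exprVn exprnN; exact: eP.
exists (Num.max C C') => k; rewrite le_max; apply/orP; case: k => k; last first.
  by left; rewrite NegzE; exact: CP.
by right; have := CP' k; rewrite exprz_inv opprK.
Qed.

Lemma powers_bounded (S : 'M[K]_n) : S \is a GRing.unit ->
  (forall x : V, x != 0 ->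
    exists2 e : rat, 0 < e & forall k : int, e <= padic_vnorm (S ^ k *m x)) ->
  exists2 C : rat, 0 < C &
    forall (k : int) (x : V), padic_vnorm (S ^ k *m x) <= C * padic_vnorm x.
Proof.
move=> Su bnd.
have [f fP] := @choice _ _ _ (fun c : 'I_n => orbits_bounded (delta_mx c 0) Su bnd).
pose C := \big[Num.max/1]_c f c.
have C0 : 0 < C by apply: (@lt_le_trans _ _ 1) => //; exact: bigmax_ge_id.
have fC c : f c <= C by exact: (le_bigmax _ f).
exists C => // k x.
have -> : S ^ k *m x = \sum_c x c 0 *: (S ^ k *m delta_mx c 0).
  rewrite {1}(_ : x = \sum_c x c 0 *: delta_mx c 0).
    by rewrite mulmx_sumr; apply: eq_bigr => c _; rewrite scalemxAr.
  by rewrite {1}[x]matrix_sum_delta; apply: eq_bigr => c _; rewrite big_ord1.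
elim/big_ind: _ => [|a b ha hb|c _].
- by rewrite padic_vnorm0 mulr_ge0 ?padic_vnorm_ge0 // ltW.
- exact: padic_vnormD_le.
rewrite padic_vnormZ mulrC ler_pM ?padic_norm_ge0 ?padic_vnorm_ge0 ?padic_norm_coord //.
exact: le_trans (fP c k) (fC c).
Qed.

(** The difference of directions is [S ^ k *m w] with [w = a *: x - b *: y] and [a] of norm at least
    [C^-1]. If [w] is shorter than [a], then [a] and [b] have equal norms, so they coincide and
    [w = a *: (x - y)]. Either way [w] has norm at least that of [x - y] over [C], and undoing
    [S ^ k] costs another factor [C]. *)
Lemma bounded_normalize_separated (S : 'M[K]_n) (C : rat) (x y : V) :
  S \is a GRing.unit -> 0 < C ->
  (forall (k : int) (z : V), padic_vnorm (S ^ k *m z) <= C * padic_vnorm z) ->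
  padic_vnorm x = 1 -> padic_vnorm y = 1 -> x != y ->
  separated (fun k => padic_normalize (S ^ k *m x)) (fun k => padic_normalize (S ^ k *m y)).
Proof.
move=> Su C0 SC x1 y1 xy; pose e := padic_vnorm (x - y) / (C * C).
have xy_gt0 : 0 < padic_vnorm (x - y) by rewrite padic_vnorm_gt0 subr_eq0.
have xy_le1 : padic_vnorm (x - y) <= 1.
  by apply: padic_vnormD_le; rewrite ?padic_vnormN ?x1 ?y1.
exists e; first by rewrite divr_gt0 // mulr_gt0.
move=> k.
have neq0 (z : V) : padic_vnorm z = 1 -> S ^ k *m z != 0.
  by move=> z1; apply: exprz_mulmx_neq0 => //; rewrite -padic_vnorm_gt0 z1.
have Skx0 := neq0 x x1; have Sky0 := neq0 y y1.
have Skx_gt0 : 0 < padic_vnorm (S ^ k *m x) by rewrite padic_vnorm_gt0.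
have [a [b [aE bE abE ->]]] : exists a b : K,
    [/\ `|a|_p = (padic_vnorm (S ^ k *m x))^-1,
        `|b|_p = (padic_vnorm (S ^ k *m y))^-1,
        padic_vnorm (S ^ k *m x) = padic_vnorm (S ^ k *m y) -> a = b
      & padic_normalize (S ^ k *m x) - padic_normalize (S ^ k *m y)
        = S ^ k *m (a *: x - b *: y)].
  exists (ratr (padic_vnorm (S ^ k *m x))), (ratr (padic_vnorm (S ^ k *m y))).
  split; [exact: ratr_vnorm_norm|exact: ratr_vnorm_norm|by move=> ->|].
  by rewrite mulmxBr -!scalemxAr.
have aC : C^-1 <= `|a|_p.
  by rewrite aE lef_pV2 ?posrE // (le_trans (SC k x)) // x1 mulr1.
set w := a *: x - b *: y.
have wC : padic_vnorm w <= C * padic_vnorm (S ^ k *m w).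
  apply: le_trans (SC (- k) _); rewrite -(exprz_mulmxD _ _ _ Su) addNr.
  by rewrite mul1mx.
have Ci : 0 < C^-1 by rewrite invr_gt0.
suff wxy : padic_vnorm (x - y) / C <= padic_vnorm w.
  rewrite /e invfM mulrA ler_pdivrMr // [X in _ <= X]mulrC.
  exact: le_trans wxy wC.
have [wa|aw] := ltP (padic_vnorm w) `|a|_p; last first.
  apply: le_trans aw; apply: le_trans aC.
  by rewrite ler_piMl // ltW.
have ax : padic_vnorm (a *: x) = `|a|_p by rewrite padic_vnormZ x1 mulr1.
have bY : padic_vnorm (b *: y) = `|b|_p by rewrite padic_vnormZ y1 mulr1.
have ab : a = b.
  apply: abE; apply: invr_inj; rewrite -aE -bE -ax -bY.
  by apply/esym/padic_vnorm_eq; rewrite padic_vnormB ax.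
by rewrite /w -ab -scalerBr padic_vnormZ mulrC ler_wpM2r // ltW.
Qed.

Lemma padic_norm_unit_part (a : K) : a != 0 -> `|ratr `|a|_p * a|_p = 1.
Proof.
move=> a0; have [k ak] := padic_normE a0.
have p0 : p%:R != 0 :> rat by rewrite gt_eqF // p_gt0.
by rewrite padic_normM ak padic_norm_ratr ratpabs_p // -expfzDr // addNr.
Qed.

(** At each time both directions change by the same scalar of norm 1. *)
Lemma separated_normalizeZ (a : int -> K) (u v : int -> V) :
  (forall k, a k != 0) ->
  separated (fun k => padic_normalize (a k *: u k)) (fun k => padic_normalize (a k *: v k)) ->
  separated (fun k => padic_normalize (u k)) (fun k => padic_normalize (v k)).
Proof.
move=> a0 [e e0 eP]; exists e; first done.
move=> k; have := eP k.
by rewrite !padic_normalizeZ -scalerBr padic_vnormZ padic_norm_unit_part // mul1r.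
Qed.

Lemma distal_scale_distal_sphere (T : 'M[K]_n) (Tu : T \in unitmx) (b : K) : b != 0 ->
  distal (fun x : V => (b *: T) *m x) -> distal (sphere_map Tu).
Proof.
move=> b0 D; apply/distal_sphere_mapP => x y x1 y1 xy.
have Su : b *: T \is a GRing.unit by rewrite scaler_unit // unitfE.
have [C C0 SC] := powers_bounded Su ((distal_mulmxP Su).1 D).
apply: (@separated_normalizeZ (fun k => b ^ k)).
  by move=> k; rewrite expfz_neq0.
have [e e0 eP] := bounded_normalize_separated Su C0 SC x1 y1 xy.
exists e; first done.
move=> k; have := eP k.
by rewrite (scaler_exprz _ b0 Tu) -!scalemxAl.
Qed.

Lemma distal_sphere_det1 (S : 'M[K]_n) : S \is a GRing.unit -> `|\det S|_p = 1 ->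
  (forall x y : V, padic_vnorm x = 1 -> padic_vnorm y = 1 -> x != y ->
    separated (fun k => padic_normalize (S ^ k *m x)) (fun k => padic_normalize (S ^ k *m y))) ->
  distal (fun x : V => S *m x).
Proof.
by move=> Su S1 sep; apply/(distal_mulmxP Su)/det1_orbit_bound.
Qed.

(** If [\det T] has norm [p ^ l], that of [T ^+ n] has norm [p ^ (l * n)], and scaling the [n]
    columns by [p ^ l] cancels it exactly. *)
Lemma distal_sphere_normalized_power (T : 'M[K]_n) (Tu : T \in unitmx) :
  distal (sphere_map Tu) ->
  exists l : int, distal (fun x : V => (p%:R ^ l *: T ^+ n) *m x).
Proof.
move=> /distal_sphere_mapP sep.
have Tu' : T \is a GRing.unit by exact: Tu.
have detT0 : \det T != 0 by move: Tu; rewrite unitmxE unitfE.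
have [l detT] := padic_normE detT0.
have p0 : p%:R != 0 :> rat by rewrite gt_eqF // p_gt0.
have pl0 : (p%:R ^ l : K) != 0.
  by rewrite -padic_norm_eq0 padic_norm_pexp gt_eqF // exprz_gt0 // p_gt0.
have Tnu : T ^+ n \is a GRing.unit by exact: unitrX.
have plu : (p%:R ^ l : K) \is a GRing.unit by rewrite unitfE.
exists l; apply: distal_sphere_det1.
- rewrite (scaler_unit _ plu); exact: Tnu.
- rewrite detZ padic_normM padic_norm_detX detT padic_normX padic_norm_pexp.
  by rewrite -exprMn -expfzDr // addNr expr1n.
move=> x y x1 y1 xy; have [e e0 eP] := sep x y x1 y1 xy.
exists e; first done.
(* Powers of [p] do not change directions, so the new orbit is the old one sampled at multiples of
   [n]. *)
move=> k; have := eP (n%:Z * k).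
rewrite (scaler_exprz _ pl0 Tnu) -!scalemxAl (exprz_exp (p%:R : K)) !padic_normalizeZp.
have -> : (T ^+ n) ^ k = T ^ (n%:Z * k) by exact: (exprz_exp T n%:Z k).
exact.
Qed.

End ProjectiveDistality.

Theorem proposition2p3 (p : nat) (p_pr : prime p) (n : nat) (n_gt0 : (0 < n)%N)
    (T : 'M[Qp p_pr]_n) (T_unit : T \in unitmx) :
  [/\ (exists b : Qp p_pr,
         b != 0 /\ distal (fun x : 'cV[Qp p_pr]_n => (b *: T) *m x)) ->
      distal (sphere_map T_unit),
      distal (sphere_map T_unit) ->
      exists (m : nat) (l : int),
        (0 < m)%N /\
        distal (fun x : 'cV[Qp p_pr]_n => (p%:R ^ l *: T ^+ m) *m x)
    & `|\det T|_p = 1 -> distal (sphere_map T_unit) ->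
      distal (fun x : 'cV[Qp p_pr]_n => T *m x)].
Proof.
case: n n_gt0 T T_unit => // n' _ T T_unit.
split=> [[b [b0 D]]|D|detT D].
- exact: distal_scale_distal_sphere b0 D.
- have [l Dl] := distal_sphere_normalized_power D.
  by exists n'.+1, l.
- apply: (distal_sphere_det1 T_unit detT).
  exact: (distal_sphere_mapP T_unit).1 D.
Qed.
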